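(* Suppose the following hold. (1) The sets $\mathbb{U}$, $\mathbb{W}$, $\mathbb{Z}$, $\mathbb{X}_f$ are closed, convex, and contain the origin; $\mathbb{U}$ and $\mathbb{W}$ are bounded; and $\mathbb{W}$ contains the origin in its interior. (2) $Q,R,P\succeq 0$. (3) There exists $K_f\in\mathbb{R}^{m\times n}$ such that $P-Q-K_f'RK_f\succeq (A+BK_f)'P(A+BK_f)$; moreover $\mathbb{X}_f$ contains the origin in its interior, and $(x,K_fx)\in\mathbb{Z}$ and $(A+BK_f)x+Gw\in\mathbb{X}_f$ for all $x\in\mathbb{X}_f$ and $w\in\mathbb{W}$. Then the feasible set $\mathcal{X}$ is robustly positively invariant for the closed-loop system $x^+=Ax+B\kappa_d(x)+Gw$ (i.e., $x^+\in\mathcal{X}$ for all $x\in\mathcal{X}$, $w\in\mathbb{W}$, $d\in\mathcal{D}$), and $$\limsup_{k\to\infty}\mathcal{J}_k(x,d,\mathbb{P})\le \max_{\Sigma\in\mathbb{B}_d}\mathrm{tr}(G'PG\Sigma)$$ for all $x\in\mathcal{X}$, $d\in\mathcal{D}$, and $\mathbb{P}\in\mathcal{P}_d^{\infty}$.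
   Context: System: $x^+=Ax+Bu+Gw$ with $A\in\mathbb{R}^{n\times n}$, $B\in\mathbb{R}^{n\times m}$, $G\in\mathbb{R}^{n\times q}$, input set $\mathbb{U}\subseteq\mathbb{R}^m$, disturbance set $\mathbb{W}\subseteq\mathbb{R}^q$, state-input constraint set $\mathbb{Z}\subseteq\mathbb{R}^n\times\mathbb{U}$, terminal set $\mathbb{X}_f\subseteq\mathbb{R}^n$, horizon $N\ge 1$. A prime denotes transpose; positive (semi)definite matrices are symmetric. Policies: $\Theta$ is the set of pairs $\theta=(\mathbf{M},\mathbf{v})$ with $\mathbf{v}=(v(0),\dots,v(N-1))\in\mathbb{R}^{Nm}$ and $\mathbf{M}\in\mathbb{R}^{Nm\times Nq}$ having blocks $M(i,j)\in\mathbb{R}^{m\times q}$ ($0\le i,j\le N-1$) with $M(i,j)=0$ for $j\ge i$. Given $x\in\mathbb{R}^n$, $\theta\in\Theta$, $\mathbf{w}=(w(0),\dots,w(N-1))$, put $u(i)=v(i)+\sum_{j=0}^{i-1}M(i,j)w(j)$, $x(0)=x$, $x(i+1)=Ax(i)+Bu(i)+Gw(i)$. $\Pi(x)$ is the set of $\theta\in\Theta$ such that for all $\mathbf{w}\in\mathbb{W}^N$: $(x(k),u(k))\in\mathbb{Z}$ for $k=0,\dots,N-1$ and $x(N)\in\mathbb{X}_f$. Feasible set: $\mathcal{X}=\{x\in\mathbb{R}^n:\Pi(x)\ne\emptyset\}$. Cost: $\ell(x,u)=x'Qx+u'Ru$, $V_f(x)=x'Px$, $J(x,\theta,\mathbf{w})=\sum_{k=0}^{N-1}\ell(x(k),u(k))+V_f(x(N))$.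 Ambiguity: $\mathcal{M}(S)$ is the set of probability distributions with zero mean for which the random variable lies in $S$ with probability one. For $d=(\varepsilon,\widehat\Sigma)$ with $\varepsilon\ge 0$, $\widehat\Sigma\succeq 0$ in $\mathbb{R}^{q\times q}$, let $\mathbb{B}_d=\{\Sigma\succeq 0:\mathrm{tr}(\widehat\Sigma+\Sigma-2(\widehat\Sigma^{1/2}\Sigma\widehat\Sigma^{1/2})^{1/2})\le\varepsilon^2\}$ and $\mathcal{P}_d=\{\mathbb{P}\in\mathcal{M}(\mathbb{W}):\mathbb{E}_{\mathbb{P}}[ww']\in\mathbb{B}_d\}$. $\mathcal{D}$ is the set of all such $d$ for which every $\Sigma\in\mathbb{B}_d$ equals $\mathbb{E}_{\mathbb{P}}[ww']$ for some $\mathbb{P}\in\mathcal{M}(\mathbb{W})$. $\mathcal{P}_d^N$ (resp. $\mathcal{P}_d^\infty$) is the set of distributions of $(w(0),\dots,w(N-1))$ (resp. of $\mathbf{w}_\infty=(w(0),w(1),\dots)$) such that the $w(k)$ are independent and each $w(k)$ has distribution in $\mathcal{P}_d$. Controller: $V_d(x,\theta)=\max_{\mathbb{P}\in\mathcal{P}_d^N}\mathbb{E}_{\mathbb{P}}[J(x,\theta,\mathbf{w})]$, $V_d^0(x)=\min_{\theta\in\Pi(x)}V_d(x,\theta)$, and $\theta_d^0(x)$ is the set of minimizers. For each $d\in\mathcal{D}$, $\kappa_d:\mathcal{X}\to\mathbb{U}$ is a single-valued Borel measurable selection with $\kappa_d(x)\in\{v^0(0):(\mathbf{M}^0,\mathbf{v}^0)\in\theta_d^0(x)\}$.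 $\phi_d(k;x,\mathbf{w}_\infty)$ is the state at time $k$ of $x^+=Ax+B\kappa_d(x)+Gw$ started at $x$ with disturbance sequence $\mathbf{w}_\infty\in\mathbb{W}^\infty$. Average performance, $k\ge 1$: $\mathcal{J}_k(x,d,\mathbb{P})=\mathbb{E}_{\mathbb{P}}\big[\frac1k\sum_{i=0}^{k-1}\ell(\phi_d(i;x,\mathbf{w}_\infty),\kappa_d(\phi_d(i;x,\mathbf{w}_\infty)))\big]$. *)

(* Defs.v *)
From HB Require Import structures.
From mathcomp Require Import all_boot all_order all_algebra.
From mathcomp Require Import all_classical all_reals all_analysis.

Set Implicit Arguments.
Unset Strict Implicit.
Unset Printing Implicit Defensive.

Import Order.TTheory GRing.Theory Num.Theory.
Import numFieldNormedType.Exports.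

Local Open Scope classical_set_scope.
Local Open Scope ring_scope.

Definition is_max d (T : porderType d) (S : set T) (v : T) : Prop :=
  S v /\ ubound S v.

(* For a column vector x, the 1 x 1 matrix x^T *m S *m x read as a scalar. *)
Definition quad (R : realType) n (S : 'M[R]_n) (x : 'cV[R]_n) : R :=
  (x^T *m S *m x) ord0 ord0.

Definition psd (R : realType) n (S : 'M[R]_n) : Prop :=
  S^T = S /\ forall x : 'cV[R]_n, 0 <= quad S x.

Definition loewner_ge (R : realType) n (S T : 'M[R]_n) : Prop := psd (S - T).

(* The positive semidefinite square root; it is unique when S is positive
   semidefinite, and the default 0 is only returned when there is none. *)
Definition psd_sqrt (R : realType) n (S : 'M[R]_n) : 'M[R]_n :=
  xget 0 [set T : 'M[R]_n | psd T /\ T *m T = S].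

(* R^q with its Borel sigma-algebra. *)
Definition borel (R : realType) (q : nat) :=
  g_sigma_algebraType (@open 'cV[R]_q).

(* Families (w k)_(k : I) of vectors of R^q with the product sigma-algebra:
   I = 'I_N for finite disturbance sequences, I = nat for infinite ones. *)
Definition cylinders (R : realType) (I : Type) (q : nat) :
    set (set (I -> 'cV[R]_q)) :=
  [set C | exists (k : I) (E : set (borel R q)),
     measurable E /\ C = [set w | E (w k)]].

Definition paths (R : realType) (I : Type) (q : nat) :=
  g_sigma_algebraType (@cylinders R I q).

(* M(S): S is assumed measurable. *)
Definition zero_mean_on (R : realType) q (S : set 'cV[R]_q)
    (P : probability (borel R q) R) : Prop :=
  P S = 1%E /\
  forall i : 'I_q,
    P.-integrable setT (fun w : borel R q => ((w : 'cV[R]_q) i ord0)%:E) /\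
    'E_P[fun w : borel R q => (w : 'cV[R]_q) i ord0]%E = 0%E.

(* E_P[w w^T] = S, entrywise. *)
Definition second_moment (R : realType) q (P : probability (borel R q) R)
    (S : 'M[R]_q) : Prop :=
  forall i j : 'I_q,
    'E_P[fun w : borel R q =>
           ((w : 'cV[R]_q) i ord0 * (w : 'cV[R]_q) j ord0)%R]%E = (S i j)%:E.

(* Ambiguity parameters d = (radius, nominal covariance). *)
Definition ambiguity (R : realType) (q : nat) := (R * 'M[R]_q)%type.

Definition cov_ball (R : realType) q (d : ambiguity R q) : set 'M[R]_q :=
  [set S | psd S /\
     \tr (d.2 + S - 2%:R *: psd_sqrt (psd_sqrt d.2 *m S *m psd_sqrt d.2))
       <= d.1 ^+ 2].

Definition amb_set (R : realType) q (W : set 'cV[R]_q) (d : ambiguity R q) :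
    set (probability (borel R q) R) :=
  [set P | zero_mean_on W P /\ exists2 S, cov_ball d S & second_moment P S].

Definition admissible_amb (R : realType) q (W : set 'cV[R]_q) :
    set (ambiguity R q) :=
  [set d | [/\ 0 <= d.1, psd d.2 &
     forall S, cov_ball d S ->
       exists2 P : probability (borel R q) R,
         zero_mean_on W P & second_moment P S]].

(* Mutual independence of the coordinates of a random family. *)
Definition independent_coords (R : realType) (I : eqType) q
    (P : probability (paths R I q) R) : Prop :=
  forall (s : seq I) (E : I -> set (borel R q)),
    uniq s -> (forall k, measurable (E k)) ->
    P [set w | forall k, k \in s -> E k (w k)] =
    (\prod_(k <- s) P [set w | E k (w k)])%E.

(* Laws of families with independent coordinates, each of which has its
   marginal law mu in the ambiguity set. *)
Definition amb_set_prod (R : realType) (I : eqType) q (W : set 'cV[R]_q)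
    (d : ambiguity R q) : set (probability (paths R I q) R) :=
  [set P | independent_coords P /\
     forall k : I, exists2 mu, amb_set W d mu &
       forall E : set (borel R q), measurable E ->
         P [set w | E (w k)] = mu E].

Record mpc (R : realType) (n m q : nat) := Mpc {
  mA : 'M[R]_n;
  mB : 'M[R]_(n, m);
  mG : 'M[R]_(n, q);
  Uset : set 'cV[R]_m;
  Wset : set 'cV[R]_q;
  Zset : set ('cV[R]_n * 'cV[R]_m);
  Xfset : set 'cV[R]_n;
  cQ : 'M[R]_n;
  cR : 'M[R]_m;
  cP : 'M[R]_n;
  horizon : nat }.

Definition step (R : realType) n m q (sys : mpc R n m q)
    (x : 'cV[R]_n) (u : 'cV[R]_m) (w : 'cV[R]_q) : 'cV[R]_n :=
  mA sys *m x + mB sys *m u + mG sys *m w.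

Definition stage_cost (R : realType) n m q (sys : mpc R n m q)
    (x : 'cV[R]_n) (u : 'cV[R]_m) : R := quad (cQ sys) x + quad (cR sys) u.

(* A pair (M, v) with M given by its blocks M i j. *)
Definition policy (R : realType) n m q (sys : mpc R n m q) :=
  (('I_(horizon sys) -> 'I_(horizon sys) -> 'M[R]_(m, q)) *
   ('I_(horizon sys) -> 'cV[R]_m))%type.

Definition causal (R : realType) n m q (sys : mpc R n m q) :
    set (policy sys) :=
  [set theta | forall i j : 'I_(horizon sys), (i <= j)%N -> theta.1 i j = 0].

Definition input (R : realType) n m q (sys : mpc R n m q) (theta : policy sys)
    (w : 'I_(horizon sys) -> 'cV[R]_q) (i : 'I_(horizon sys)) : 'cV[R]_m :=
  theta.2 i + \sum_(j < horizon sys | (j < i)%N) theta.1 i j *m w j.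

(* The value at k of a finite sequence; 0 (never used) beyond its length. *)
Definition at_time (V : nmodType) N (f : 'I_N -> V) (k : nat) : V :=
  oapp f 0 (insub k).

(* x(k), meaningful for k <= horizon sys. *)
Fixpoint state (R : realType) n m q (sys : mpc R n m q) (x : 'cV[R]_n)
    (theta : policy sys) (w : 'I_(horizon sys) -> 'cV[R]_q) (k : nat) :
    'cV[R]_n :=
  if k is i.+1
  then step sys (state x theta w i) (at_time (input theta w) i) (at_time w i)
  else x.

Definition feasible_policy (R : realType) n m q (sys : mpc R n m q)
    (x : 'cV[R]_n) : set (policy sys) :=
  [set theta | causal theta /\
     forall w : 'I_(horizon sys) -> 'cV[R]_q, (forall k, Wset sys (w k)) ->
       (forall k : 'I_(horizon sys),
          Zset sys (state x theta w k, input theta w k)) /\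
       Xfset sys (state x theta w (horizon sys))].

Arguments feasible_policy {R n m q} sys x.

Definition feasible (R : realType) n m q (sys : mpc R n m q) : set 'cV[R]_n :=
  [set x | feasible_policy sys x !=set0].

Definition cost (R : realType) n m q (sys : mpc R n m q) (x : 'cV[R]_n)
    (theta : policy sys) (w : 'I_(horizon sys) -> 'cV[R]_q) : R :=
  \sum_(k < horizon sys) stage_cost sys (state x theta w k) (input theta w k)
  + quad (cP sys) (state x theta w (horizon sys)).

(* V_d(x, theta); the supremum is the maximum when the latter exists. *)
Definition worst_cost (R : realType) n m q (sys : mpc R n m q)
    (d : ambiguity R q) (x : 'cV[R]_n) (theta : policy sys) : \bar R :=
  ereal_sup [set ('E_P[cost x theta])%E |
              P in @amb_set_prod R 'I_(horizon sys) q (Wset sys) d].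

Definition optimal_cost (R : realType) n m q (sys : mpc R n m q)
    (d : ambiguity R q) (x : 'cV[R]_n) : \bar R :=
  ereal_inf [set worst_cost d x theta | theta in feasible_policy sys x].

Definition optimal_policy (R : realType) n m q (sys : mpc R n m q)
    (d : ambiguity R q) (x : 'cV[R]_n) : set (policy sys) :=
  [set theta | feasible_policy sys x theta /\
     worst_cost d x theta = optimal_cost sys d x].

Arguments optimal_policy {R n m q} sys d x.

(* kappa is a Borel measurable selection, on the feasible set and with values
   in the input set, of the first inputs of the optimal policies; hN makes 0 an
   index of the horizon. Values of kappa off the feasible set are irrelevant. *)
Definition control_law (R : realType) n m q (sys : mpc R n m q)
    (hN : (0 < horizon sys)%N) (d : ambiguity R q)
    (kappa : 'cV[R]_n -> 'cV[R]_m) : Prop :=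
  [/\ measurable_fun (feasible sys : set (borel R n))
        (kappa : borel R n -> borel R m),
      (forall x, feasible sys x -> Uset sys (kappa x)) &
      forall x, feasible sys x ->
        exists2 theta, optimal_policy sys d x theta &
          kappa x = theta.2 (Ordinal hN)].

Fixpoint closed_loop (R : realType) n m q (sys : mpc R n m q)
    (kappa : 'cV[R]_n -> 'cV[R]_m) (x : 'cV[R]_n) (w : nat -> 'cV[R]_q)
    (k : nat) : 'cV[R]_n :=
  if k is i.+1
  then let y := closed_loop sys kappa x w i in step sys y (kappa y) (w i)
  else x.

(* The expectation is taken on W^oo, which has probability one: outside it the
   closed loop may leave the domain of kappa. *)
Definition avg_performance (R : realType) n m q (sys : mpc R n m q)
    (kappa : 'cV[R]_n -> 'cV[R]_m) (x : 'cV[R]_n)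
    (P : probability (paths R nat q) R) (k : nat) : \bar R :=
  (\int[P]_(w in [set w : paths R nat q | forall i, Wset sys (w i)])
     ((k%:R^-1 * \sum_(i < k)
        stage_cost sys (closed_loop sys kappa x w i)
          (kappa (closed_loop sys kappa x w i)))%R)%:E)%E.

(* Main.v *)
Require Import Defs.
From HB Require Import structures.
From mathcomp Require Import all_boot all_order all_algebra.
From mathcomp Require Import all_classical all_reals all_analysis.
From mathcomp Require Import measurable_realfun.
From mathcomp Require Import ring lra.

Import Order.TTheory GRing.Theory Num.Theory.
Import numFieldNormedType.Exports.

Local Open Scope classical_set_scope.
Local Open Scope ring_scope.

Set Implicit Arguments.
Unset Strict Implicit.
Unset Printing Implicit Defensive.

(** An optimal policy prescribes inputs that are affine in the past
    disturbances. Once the first disturbance [w0] is known, its tail, followed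
    by the terminal feedback [Kf], is a policy for the successor state; it
    reproduces the trajectories of the original policy, so it is feasible
    ([feasible_shift]), which gives robust invariance.

    For the cost bound, the expectation of a quadratic cost under a law with
    independent centred coordinates depends on the law only through the
    covariances [S j] of the coordinates: it is the nominal cost plus
    [sum_j tr (H_j S_j)], where [H_j] depends on the feedback blocks of the
    policy alone ([cost_mean], [sensitivity]). The ball of covariances is
    compact ([cov_ball_max]), so the worst case of a policy is attained at
    covariances that maximize each [tr (H_j S)] separately ([worst_costE]).
    The feedback blocks of the shifted policy do not involve [w0]: one choice
    of worst covariances serves all values of [w0], and the average over [w0]
    of the worst cost of the shifted policy is the expected cost, under one
    product law, of the original policy continued by one step. Telescoping the
    stage costs and using the Lyapunov inequality for [Kf] yields, for
    the value function [V],
      [E V(x+) + l(x, kappa x) <= V(x) + max_S tr (G' P G S)]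
    ([expected_cost_shift], [optimal_cost_decrease]). Summing over [k] steps of
    the closed loop and dividing by [k] gives the claim, since [V] is
    nonnegative and finite at the initial state ([mean_running_cost_sum],
    [limsup_avg_performance]).

    Three facts support this computation. The closed-loop state at time [i] is
    independent of the disturbance at time [i]: this is used in the form that
    replacing one coordinate of a product law by an independent copy preserves
    the law ([resampleE]), and the same operation constructs the finite product
    laws that the worst case needs ([product_law_exists]). The value function
    is Borel because its sublevel sets are projections of closed sets, hence
    countable unions of compact sets ([optimal_cost_measurable]). Compactness of
    the covariance ball rests on existence and uniqueness of positive
    semidefinite square roots ([psd_sqrt_exists], [psd_sqrt_unique]). *)

(** * Topology of matrix spaces *)

Lemma continuous_mx (R : realType) (T : topologicalType) (m n : nat)
    (f : T -> 'M[R]_(m, n)) :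
  (forall i j, continuous (fun x => f x i j)) -> continuous f.
Proof.
move=> cf x A [P nP sPA]; apply: filterS (_ : nbhs x
  (fun y => forall i, forall j, P i j (f y i j))) => [y Py|]; first exact: sPA.
by do 2!apply: filter_forall => ?; exact/cf/nP.
Qed.

Lemma continuous_entry (R : realType) (T : topologicalType) (m n : nat)
    (f : T -> 'M[R]_(m, n)) i j :
  continuous f -> continuous (fun x => f x i j).
Proof.
move=> cf x.
exact: (continuous_comp (f := f) (g := fun M : 'M[R]_(m, n) => M i j) (cf x)
  (@coord_continuous _ _ _ _ _ _)).
Qed.

Lemma continuous_add (R : realType) (T : topologicalType)
    (V : normedModType R) (f g : T -> V) :
  continuous f -> continuous g -> continuous (fun x => f x + g x).
Proof. by move=> cf cg x; apply: cvgD; [exact: cf|exact: cg]. Qed.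

Lemma continuous_sum (R : realType) (T : topologicalType) (I : Type)
    (r : seq I) (p : pred I) (V : normedModType R) (f : I -> T -> V) :
  (forall i, continuous (f i)) ->
  continuous (fun x => \sum_(i <- r | p i) f i x).
Proof.
move=> cf; elim: r => [|i r ih].
  by under eq_fun do rewrite big_nil; exact: cst_continuous.
under eq_fun do rewrite big_cons; case: (p i) => //.
by move=> x; apply: cvgD; [exact: cf|exact: ih].
Qed.

Lemma continuous_mulmx (R : realType) (T : topologicalType) (m n p : nat)
    (f : T -> 'M[R]_(m, n)) (g : T -> 'M[R]_(n, p)) :
  continuous f -> continuous g -> continuous (fun x => f x *m g x).
Proof.
move=> cf cg; apply: continuous_mx => i j; under eq_fun do rewrite mxE.
apply: continuous_sum => k x.
by apply: cvgM; apply: continuous_entry.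
Qed.

Lemma continuous_trmx (R : realType) (T : topologicalType) (m n : nat)
    (f : T -> 'M[R]_(m, n)) :
  continuous f -> continuous (fun x => (f x)^T).
Proof.
move=> cf; apply: continuous_mx => i j; under eq_fun do rewrite mxE.
exact: continuous_entry.
Qed.

Lemma continuous_mxtrace (R : realType) (T : topologicalType) (n : nat)
    (f : T -> 'M[R]_n) :
  continuous f -> continuous (fun x => \tr (f x)).
Proof. by move=> cf; apply: continuous_sum => i; exact: continuous_entry. Qed.

Lemma continuous_quad (R : realType) (T : topologicalType) (n : nat)
    (S : T -> 'M[R]_n) (f : T -> 'cV[R]_n) :
  continuous S -> continuous f -> continuous (fun x => quad (S x) (f x)).
Proof.
move=> cS cf; apply: continuous_entry; apply: continuous_mulmx => //.
by apply: continuous_mulmx => //; exact: continuous_trmx.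
Qed.

Lemma continuous_quadr (R : realType) (n : nat) (S : 'M[R]_n) :
  continuous (quad S : 'cV[R]_n -> R).
Proof.
by apply: (@continuous_quad _ _ _ (fun=> S) id) => x;
  [exact: cst_continuous|exact: cvg_id].
Qed.

Lemma entry_le_norm (R : realType) (m n : nat) (M : 'M[R]_(m, n)) i j :
  `|M i j| <= `|M|.
Proof.
rewrite [leRHS]/Num.norm /= mx_normrE; apply/bigmax_geP; right => /=.
by exists (i, j).
Qed.

Lemma norm_le_entries (R : realType) (m n : nat) (M : 'M[R]_(m, n)) c :
  0 <= c -> (forall i j, `|M i j| <= c) -> `|M| <= c.
Proof.
move=> c0 hM; rewrite [leLHS]/Num.norm /= mx_normrE; apply/bigmax_leP.
by split => // -[i j] _; exact: hM.
Qed.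

(** Heine-Borel for row vectors, transported along the bijection [vec_mx]. *)
Lemma compact_mx (R : realType) (m n : nat) (A : set 'M[R]_(m, n)) c :
  (forall M, A M -> forall i j, `|M i j| <= c) -> closed A -> compact A.
Proof.
move=> bA cA.
have cvec : continuous (@vec_mx R m n).
  apply: continuous_mx => i j; under eq_fun do rewrite mxE.
  exact: coord_continuous.
have -> : A = vec_mx @` (vec_mx @^-1` A).
  apply/seteqP; split => [M AM|M [v Av <-]//].
  by exists (mxvec M); rewrite /= mxvecK.
apply: continuous_compact; first exact: continuous_subspaceT.
apply: bounded_closed_compact; last first.
  by apply: closed_comp => // v _; exact: cvec.
exists `|c|; split; first exact: num_real.
move=> y cy v /= Av; apply: norm_le_entries.
  by rewrite (le_trans (normr_ge0 c)) ?(ltW cy).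
move=> i k; rewrite ord1 -[v]vec_mxK; case/mxvec_indexP: k => a b.
rewrite mxvecE (le_trans (bA _ Av a b))// (le_trans (ler_norm c))//.
exact: ltW.
Qed.

Lemma closed_le_fun (R : realType) (T : topologicalType) (f : T -> R) c :
  continuous f -> closed [set x | f x <= c].
Proof.
move=> cf; apply: (@closed_comp _ _ f [set y | y <= c]) => //.
Qed.

Lemma closed_ge_fun (R : realType) (T : topologicalType) (f : T -> R) c :
  continuous f -> closed [set x | c <= f x].
Proof.
move=> cf; apply: (@closed_comp _ _ f [set y | c <= y]) => //.
Qed.

Lemma closed_eq0_mx (R : realType) (T : topologicalType) m n
    (f : T -> 'M[R]_(m, n)) :
  continuous f -> closed [set x | f x = 0].
Proof.
move=> cf; apply: (@closed_comp _ _ f [set 0]) => //.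
exact/accessible_closed_set1/hausdorff_accessible/norm_hausdorff.
Qed.

Lemma compact_box (R : realType) (m n : nat) (r : R) :
  compact [set M : 'M[R]_(m, n) | forall i j, `|M i j| <= r].
Proof.
apply: (@compact_mx _ _ _ _ r) => //.
rewrite (_ : [set M | _] = \bigcap_(i in setT) \bigcap_(j in setT)
  [set M : 'M[R]_(m, n) | `|M i j| <= r]).
  apply: closed_bigI => i _; apply: closed_bigI => j _.
  apply: (@closed_le_fun _ _ (fun M : 'M[R]_(m, n) => `|M i j|)) => M.
  apply: (@continuous_comp _ _ _ (fun M : 'M[R]_(m, n) => M i j) Num.norm).
    exact: coord_continuous.
  exact: norm_continuous.
apply/seteqP; split => M /= h; first by move=> i _ j _; exact: h.
by move=> i j; exact: h.
Qed.

(** * Positive semidefinite matrices and their square roots *)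

Lemma psd_tr (R : realType) n (S : 'M[R]_n) : psd S -> S^T = S.
Proof. by case. Qed.

Lemma trmx_mx11 (R : realType) (M : 'M[R]_1) : M^T = M.
Proof. by apply/matrixP => i j; rewrite mxE !ord1. Qed.

Lemma quadD (R : realType) n (S : 'M[R]_n) (x y : 'cV[R]_n) : S^T = S ->
  quad S (x + y) = quad S x + 2%:R * (y^T *m S *m x) ord0 ord0 + quad S y.
Proof.
move=> St; rewrite /quad [(x + y)^T]linearD/= !mulmxDl !mulmxDr.
rewrite [LHS]mxE [X in X + _]mxE [X in _ + X]mxE -!addrA; congr (_ + _).
rewrite !addrA; congr (_ + _); rewrite addrC.
have -> : (x^T *m S *m y) ord0 ord0 = (y^T *m S *m x) ord0 ord0.
  rewrite -[x^T *m S *m y]trmx_mx11 !trmx_mul trmxK St.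
  by rewrite mulmxA.
by rewrite -mulr2n mulr_natl.
Qed.

Lemma quadZ (R : realType) n (S : 'M[R]_n) (a : R) (x : 'cV[R]_n) :
  quad S (a *: x) = a ^+ 2 * quad S x.
Proof.
rewrite /quad [(a *: x)^T]linearZ/= -!scalemxAl -!scalemxAr scalerA expr2.
by rewrite [LHS]mxE.
Qed.

Lemma quad_mulmx (R : realType) n m (S : 'M[R]_n) (K : 'M[R]_(n, m)) x :
  quad S (K *m x) = quad (K^T *m S *m K) x.
Proof. by rewrite /quad trmx_mul !mulmxA. Qed.

Lemma quadDl (R : realType) n (S T : 'M[R]_n) x :
  quad (S + T) x = quad S x + quad T x.
Proof. by rewrite /quad mulmxDr mulmxDl [LHS]mxE. Qed.

Lemma quadNl (R : realType) n (S : 'M[R]_n) x : quad (- S) x = - quad S x.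
Proof. by rewrite /quad mulmxN mulNmx [LHS]mxE. Qed.

Lemma quadZl (R : realType) n (S : 'M[R]_n) (l : R) x :
  quad (l *: S) x = l * quad S x.
Proof. by rewrite /quad -scalemxAr -scalemxAl [LHS]mxE. Qed.

Lemma psdD (R : realType) n (S T : 'M[R]_n) : psd S -> psd T -> psd (S + T).
Proof.
move=> [St S0] [Tt T0]; split; first by rewrite linearD/= St Tt.
by move=> x; rewrite quadDl addr_ge0.
Qed.

Lemma psd_conj (R : realType) n m (S : 'M[R]_n) (K : 'M[R]_(n, m)) :
  psd S -> psd (K^T *m S *m K).
Proof.
move=> [St S0]; split; first by rewrite !trmx_mul trmxK St mulmxA.
by move=> x; rewrite -quad_mulmx.
Qed.

(** A quadratic function [2 t c + t^2 d] that is never negative has [c = 0]: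
    a zero of a positive semidefinite form is thus a kernel vector. *)
Lemma psd_quad0 (R : realType) n (S : 'M[R]_n) (x : 'cV[R]_n) :
  psd S -> quad S x = 0 -> S *m x = 0.
Proof.
move=> [St S0] Sx0.
suff h (y : 'cV[R]_n) : (y^T *m S *m x) ord0 ord0 = 0.
  apply/matrixP => i j; rewrite (ord1 j) [RHS]mxE.
  have := h (delta_mx i ord0); rewrite trmx_delta -mulmxA -rowE.
  by rewrite mxE.
set c := (_ *m x) ord0 ord0.
have hq t : 0 <= 2%:R * t * c + t ^+ 2 * quad S y.
  have := S0 (x + t *: y); rewrite quadD// Sx0 add0r quadZ.
  by rewrite linearZ/= -!scalemxAl mxE mulrA.
have d0 := S0 y; set d := quad S y in hq d0.
apply/eqP; apply/negPn/negP => c0.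
have c2 : 0 < c ^+ 2 by rewrite exprn_even_gt0.
have e0 : d + 1 != 0 by rewrite gt_eqF// ltr_wpDl.
have := hq (- c / (d + 1)).
have -> : 2%:R * (- c / (d + 1)) * c + (- c / (d + 1)) ^+ 2 * d =
  - (c ^+ 2 * (d + 2%:R)) / (d + 1) ^+ 2 by field.
rewrite leNgt => /negP; apply.
rewrite mulNr oppr_lt0 divr_gt0 ?exprn_even_gt0//=.
by rewrite mulr_gt0//; lra.
Qed.

Lemma mxtrace_outer (R : realType) n (S : 'M[R]_n) (x : 'cV[R]_n) :
  \tr (S *m (x *m x^T)) = quad S x.
Proof.
by rewrite mulmxA mxtrace_mulC /quad mulmxA /mxtrace big_ord1.
Qed.

Lemma psd_trace_ge0 (R : realType) n (S : 'M[R]_n) : psd S -> 0 <= \tr S.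
Proof.
move=> [_ S0]; apply: sumr_ge0 => i _.
have := S0 (delta_mx i ord0).
by rewrite /quad trmx_delta -rowE -colE !mxE.
Qed.

Lemma quad_delta (R : realType) n (S : 'M[R]_n) i :
  quad S (delta_mx i ord0) = S i i.
Proof. by rewrite /quad trmx_delta -rowE -colE !mxE. Qed.

(** The diagonal of [D^T S D] lists the values of the form [S] on the columns
    of [D]. *)
Lemma psd_conj_trace0 (R : realType) n m (S : 'M[R]_n) (D : 'M[R]_(n, m)) :
  psd S -> \tr (D^T *m S *m D) = 0 -> S *m D = 0.
Proof.
move=> Sp /eqP; rewrite psumr_eq0; last first.
  by move=> i _; rewrite -quad_delta; have [_] := psd_conj D Sp; exact.
move=> /allP h; apply/matrixP => i j.
have /eqP := h j (mem_index_enum _); rewrite -quad_delta -quad_mulmx.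
move=> /(psd_quad0 Sp)/matrixP/(_ i ord0); rewrite mulmxA -colE !mxE.
by [].
Qed.

Lemma mxtrace_gram_eq0 (R : realType) n m (D : 'M[R]_(n, m)) :
  \tr (D^T *m D) = 0 -> D = 0.
Proof.
move=> h; rewrite -[D]mul1mx; apply: psd_conj_trace0.
  split; first by rewrite trmx1.
  move=> x; rewrite /quad mulmx1 mxE sumr_ge0// => i _.
  by rewrite mxE -expr2 sqr_ge0.
by rewrite mulmx1.
Qed.

(** With [D = T1 - T2] and [T1^2 = T2^2] one has [T1 D + D T2 = 0]; tracing
    against [D] gives two nonnegative numbers with zero sum, so
    [T1 D = T2 D = 0] and [D^2 = 0]. *)
Lemma psd_sqrt_unique (R : realType) n (T1 T2 : 'M[R]_n) :
  psd T1 -> psd T2 -> T1 *m T1 = T2 *m T2 -> T1 = T2.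
Proof.
move=> p1 p2 h; set D := T1 - T2.
have Dt : D^T = D by rewrite /D linearB/= (psd_tr p1) (psd_tr p2).
have e : T1 *m D + D *m T2 = 0.
  by rewrite /D mulmxBr mulmxBl h addrA subrK subrr.
have : \tr (D^T *m T1 *m D) + \tr (D^T *m T2 *m D) = 0.
  rewrite [X in _ + X]mxtrace_mulC -linearD/= Dt mulmxA -[_ *m T1 *m _]mulmxA.
  by rewrite -[D *m D *m _]mulmxA -mulmxDr e mulmx0 linear0.
move=> /eqP; rewrite paddr_eq0; last 2 first.
- exact/psd_trace_ge0/psd_conj.
- exact/psd_trace_ge0/psd_conj.
move=> /andP[/eqP/(psd_conj_trace0 p1) D1 /eqP/(psd_conj_trace0 p2) D2].
apply/eqP; rewrite -subr_eq0 -/D; apply/eqP/mxtrace_gram_eq0.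
by rewrite Dt {1}/D mulmxBl D1 D2 subr0 linear0.
Qed.

Lemma quad1E (R : realType) n (x : 'cV[R]_n) :
  quad 1%:M x = \sum_i x i ord0 ^+ 2.
Proof.
by rewrite /quad mulmx1 mxE; apply: eq_bigr => i _; rewrite mxE expr2.
Qed.

Lemma quad1_gt0 (R : realType) n (x : 'cV[R]_n) : x != 0 -> 0 < quad 1%:M x.
Proof.
move=> x0; rewrite quad1E lt_neqAle sumr_ge0 ?andbT; last first.
  by move=> i _; exact: sqr_ge0.
rewrite eq_sym psumr_neq0; last by move=> i _; exact: sqr_ge0.
have /existsP[i xi] : [exists i, x i ord0 != 0].
  apply: contraT; rewrite negb_exists => /forallP h; case/negP: x0.
  apply/eqP/matrixP => i j; rewrite ord1 [RHS]mxE.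
  by have /negPn/eqP := h i.
by apply/hasP; exists i; rewrite ?mem_index_enum//= exprn_even_gt0.
Qed.

(** A maximizer [v] of the form on the unit sphere satisfies
    [S v = l v]: indeed [l I - S] is positive semidefinite and vanishes at
    [v]. *)
Lemma psd_top_eigen (R : realType) n (S : 'M[R]_n) : psd S -> S != 0 ->
  exists v : 'cV[R]_n, exists l : R,
    [/\ 0 < l, quad 1%:M v = 1 & S *m v = l *: v].
Proof.
move=> pS S0; have [St Sge0] := pS.
have [y Sy] : exists y : 'cV[R]_n, S *m y != 0.
  apply/not_existsP => h; case/negP: S0; apply/eqP/matrixP => i j.
  have := h (delta_mx j ord0); rewrite -colE => /negP/negPn/eqP/matrixP.
  by move=> /(_ i ord0); rewrite !mxE.
have y0 : y != 0 by apply: contraNneq Sy => ->; rewrite mulmx0.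
have qy0 : 0 < quad 1%:M y := quad1_gt0 y0.
pose A := [set x : 'cV[R]_n | quad 1%:M x = 1].
have normalize z : 0 < quad 1%:M z -> A ((Num.sqrt (quad 1%:M z))^-1 *: z).
  move=> z0; rewrite /A /= quadZ exprVn sqr_sqrtr ?(ltW z0)// mulVf//.
  by rewrite gt_eqF.
have cA : compact A.
  apply: (@compact_mx _ _ _ _ 1).
    move=> M AM i j; rewrite ord1; rewrite -(ler_pXn2r (n := 2)) ?nnegrE//.
    rewrite expr1n -AM quad1E real_normK ?num_real// (bigD1 i)//= lerDl.
    by apply: sumr_ge0 => k _; exact: sqr_ge0.
  apply: (@closed_comp _ _ (quad 1%:M) [set 1]).
    by move=> x _; exact: continuous_quadr.
  exact: closed_eq.
have [v vA vmax] := @compact_EVT_max 'cV[R]_n R (quad S) A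
  (ex_intro _ _ (normalize y qy0)) cA
  (continuous_subspaceT (@continuous_quadr _ _ S)).
rewrite inE in vA; set l := quad S v in vmax.
have bound x : quad S x <= l * quad 1%:M x.
  have [->|x0] := eqVneq x 0.
    by rewrite /quad mulmx0 mulmx0 !mxE mulr0.
  have qx0 := quad1_gt0 x0.
  have := vmax _ (mem_set (normalize x qx0)).
  by rewrite quadZ exprVn sqr_sqrtr ?(ltW qx0)// ler_pdivrMl// [leRHS]mulrC.
have lp : 0 < l.
  have : 0 < quad S y.
    rewrite lt_neqAle Sge0 andbT eq_sym; apply: contraNneq Sy => h.
    by rewrite (psd_quad0 pS h).
  by move=> /lt_le_trans /(_ (bound y)); rewrite pmulr_lgt0.
exists v, l; split => //.
have pD : psd (l%:M - S).
  split; first by rewrite linearB/= tr_scalar_mx St.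
  move=> x; rewrite quadDl quadNl subr_ge0.
  by rewrite -scalemx1 quadZl; exact: bound.
have : quad (l%:M - S) v = 0.
  by rewrite quadDl quadNl -scalemx1 quadZl vA mulr1 subrr.
move=> /(psd_quad0 pD); rewrite mulmxBl mul_scalar_mx => /eqP.
by rewrite subr_eq0 => /eqP.
Qed.

(** Deflation: if [S v = l v] with [|v| = 1] and [l > 0], a root [T] of
    [S - l v v^T] kills [v], so [T + sqrt l v v^T] is a root of [S]; the
    rank drops, as [v] joins the kernel. *)
Lemma psd_sqrt_exists (R : realType) n (S : 'M[R]_n) : psd S ->
  exists T, psd T /\ T *m T = S.
Proof.
have [k] := ubnP (\rank S); elim: k S => // k ih S; rewrite ltnS => rk pS.
have [->|S0] := eqVneq S 0.
  exists 0; rewrite mulmx0; split => //; split; first by rewrite trmx0.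
  by move=> x; rewrite /quad mulmx0 mul0mx mxE.
have [v [l [l0 v1 Sv]]] := psd_top_eigen pS S0.
have [St Sge0] := pS.
pose V := v *m v^T.
have Vt : V^T = V by rewrite /V trmx_mul trmxK.
have vv : v^T *m v = 1%:M.
  apply/matrixP => i j; rewrite !ord1; move: v1.
  by rewrite /quad mulmx1 => ->; rewrite mxE.
have VV : V *m V = V by rewrite /V !mulmxA -[_ *m v^T *m v]mulmxA vv mulmx1.
have Vv : V *m v = v by rewrite /V -mulmxA vv mulmx1.
have vS : v^T *m S = l *: v^T by rewrite -{1}St -trmx_mul Sv linearZ.
have SV : S *m V = l *: V by rewrite /V mulmxA Sv scalemxAl.
have VS : V *m S = l *: V by rewrite /V -mulmxA vS scalemxAr.
have qV x : 0 <= quad V x.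
  rewrite /quad /V mulmxA -mulmxA -[x^T *m v]trmxK trmx_mul trmxK.
  by rewrite trmx_mx11 mxE big_ord1 -expr2 sqr_ge0.
have pV : psd V by split.
pose S' := S - l *: V.
have S'v : S' *m v = 0 by rewrite /S' mulmxBl Sv -scalemxAl Vv subrr.
have pS' : psd S'.
  have -> : S' = (1%:M - V)^T *m S *m (1%:M - V).
    rewrite [(_ - _)^T]linearB/= trmx1 Vt mulmxBl mul1mx VS.
    rewrite mulmxBr mulmx1 mulmxBl SV.
    by rewrite -!scalemxAl VV subrr subr0.
  exact: psd_conj.
have vS' : v^T *m S' = 0.
  by rewrite -(psd_tr pS') -trmx_mul S'v trmx0.
have rk' : (\rank S' < k)%N.
  apply: leq_trans rk; apply: rank_ltmx.
  rewrite /ltmx; apply/andP; split.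
    have -> : S' = (1%:M - V) *m S by rewrite mulmxBl mul1mx VS.
    exact: submxMl.
  apply/negP => /submxP[D SD].
  have : S *m v = 0 by rewrite SD -mulmxA S'v mulmx0.
  rewrite Sv => /eqP; rewrite scaler_eq0 (gt_eqF l0)/= => /eqP v0.
  by move: v1; rewrite v0 /quad mulmx0 mxE => /eqP; rewrite eq_sym oner_eq0.
have [T [pT TT]] := ih S' rk' pS'.
have Tv : T *m v = 0.
  apply/mxtrace_gram_eq0; rewrite trmx_mul (psd_tr pT) mulmxA.
  by rewrite -[_ *m T *m T]mulmxA TT vS' mul0mx linear0.
have TV : T *m V = 0 by rewrite /V mulmxA Tv mul0mx.
have VT : V *m T = 0 by rewrite -Vt -(psd_tr pT) -trmx_mul TV trmx0.
exists (T + Num.sqrt l *: V); split.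
  apply: psdD => //; split; first by rewrite linearZ/= Vt.
  move=> x; rewrite /quad -scalemxAr -scalemxAl mxE.
  by rewrite mulr_ge0 ?sqrtr_ge0//; exact: qV.
rewrite mulmxDl !mulmxDr -!scalemxAl -!scalemxAr TV VT !scaler0 addr0 add0r.
rewrite TT VV scalerA -expr2 sqr_sqrtr ?(ltW l0)//.
by rewrite /S' subrK.
Qed.

Lemma psd_sqrtP (R : realType) n (S : 'M[R]_n) : psd S ->
  psd (psd_sqrt S) /\ psd_sqrt S *m psd_sqrt S = S.
Proof.
move=> pS; rewrite /psd_sqrt.
case: xgetP => [T _ //|h]; have [T] := psd_sqrt_exists pS.
by move=> /h.
Qed.

Lemma psd_sqrt_eq (R : realType) n (S T : 'M[R]_n) :
  psd T -> T *m T = S -> psd_sqrt S = T.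
Proof.
move=> pT TT; have pS : psd S.
  by rewrite -TT -{1}(psd_tr pT) -[T^T]mulmx1; apply: psd_conj; split;
    [rewrite trmx1|move=> x; rewrite quad1E sumr_ge0// => i _; exact: sqr_ge0].
have [p e] := psd_sqrtP pS; apply: psd_sqrt_unique => //.
by rewrite e TT.
Qed.

(** With [S = T^2], this is the trace of [T X T]. *)
Lemma psd_trace_mul_ge0 (R : realType) n (X S : 'M[R]_n) :
  psd X -> psd S -> 0 <= \tr (X *m S).
Proof.
move=> pX pS; have [pT TT] := psd_sqrtP pS.
rewrite -TT mulmxA mxtrace_mulC mulmxA -{1}(psd_tr pT).
exact/psd_trace_ge0/psd_conj.
Qed.

(** * Borel sets of R^q, product laws and resampling *)

Lemma measurable_entry (R : realType) n (i : 'I_n) :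
  measurable_fun setT (fun x : borel R n => (x : 'cV[R]_n) i ord0).
Proof.
apply: (measurability _ (RGenOpens.measurableE R)).
move=> _ [B [a [b ->]] <-]; rewrite setTI; apply: sub_sigma_algebra => /=.
apply: (@open_comp _ _ (fun x : 'cV[R]_n => x i ord0)).
  by move=> x _; exact: coord_continuous.
exact: itv_open.
Qed.

(** Open sets of [R^n] are countable unions of rational boxes, so coordinates
    decide Borel measurability. *)
Lemma measurable_colvec (R : realType) n d (T : measurableType d) (D : set T)
    (f : T -> 'cV[R]_n) :
  (forall i, measurable_fun D (fun t => f t i ord0)) ->
  measurable_fun D (f : T -> borel R n).
Proof.
move=> mf mD; move: (mD); rewrite -/(measurable_fun D (f : T -> borel R n)).
apply: (measurability (@open 'cV[R]_n : set (set (borel R n)))) => //.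
move=> _ [U oU <-].
pose box (c : 'cV[rat]_n * 'cV[rat]_n) : set 'cV[R]_n :=
  [set x | forall i, x i ord0 \in `]ratr (c.1 i ord0), ratr (c.2 i ord0)[].
have -> : f @^-1` U = \bigcup_c
    (if `[<box c `<=` U>] then f @^-1` box c else set0).
  apply/seteqP; split => t /=; last first.
    by move=> [c _]; case: asboolP => // cU /cU.
  move=> Ut; have /nbhs_ballP[e /= e0 eU] : nbhs (f t) U.
    by move: oU; rewrite openE => /(_ _ Ut).
  have ha i : {r : rat | ratr r \in `]f t i ord0 - e, f t i ord0[}.
    by apply/cid/rat_in_itvoo; rewrite ltrBlDr ltrDl.
  have hb i : {r : rat | ratr r \in `]f t i ord0, f t i ord0 + e[}.
    by apply/cid/rat_in_itvoo; rewrite ltrDl.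
  exists (\col_i sval (ha i), \col_i sval (hb i)) => //.
  case: asboolP => /= [_ i|[]].
    rewrite !mxE; case: (ha i) => r /=; case: (hb i) => s /=.
    by rewrite !in_itv/= => /andP[fs _] /andP[_ rf]; rewrite rf.
  move=> x bx; apply: eU; split => // i j; rewrite ord1.
  have := bx i; rewrite !mxE; case: (ha i) => r /=; case: (hb i) => s /=.
  rewrite !in_itv/= => /andP[_ fs] /andP[rf _] /andP[rx xs].
  rewrite /ball/= ltr_norml; apply/andP; split.
    by rewrite ltrBDr addrC ltrBlDr (lt_trans xs)// addrC.
  by rewrite ltrBlDr -ltrBlDl (lt_trans rf).
rewrite setI_bigcupr; apply: countable_bigcupT_measurable.
  exact: countableP.
move=> c; case: ifP => _; last by rewrite setI0.
have -> : D `&` f @^-1` box c = D `&` \bigcap_(i in [set: 'I_n])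
    (D `&` (fun t => f t i ord0) @^-1`
       `]ratr (c.1 i ord0), ratr (c.2 i ord0)[%classic).
  apply/seteqP; split => t /= [Dt h]; split => //.
    by move=> i _; split => //; exact: h.
  by move=> i; have [] := h i I.
apply: measurableI => //; apply: fin_bigcap_measurable => // i _.
exact: mf.
Qed.

Lemma measurable_coordinate (R : realType) (I : Type) q (k : I) :
  measurable_fun setT (fun w : paths R I q => (w k : borel R q)).
Proof.
move=> _ E mE; rewrite setTI; apply: sub_sigma_algebra.
by exists k, E.
Qed.

Lemma measurable_paths (R : realType) (I : Type) q d (T : measurableType d)
    (f : T -> I -> 'cV[R]_q) :
  (forall k, measurable_fun setT (fun t => (f t k : borel R q))) ->
  measurable_fun setT (f : T -> paths R I q).
Proof.
move=> mf.
apply: (measurability (@cylinders R I q : set (set (paths R I q)))) => //.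
by move=> _ [_ [k [E [mE ->]]] <-]; exact: mf.
Qed.

Section resampling.
Context (R : realType) (I : eqType) (q : nat).
Implicit Types (s : seq I) (E : I -> set (borel R q)).

Definition fin_cylinder s E : set (paths R I q) :=
  [set w | forall k, k \in s -> E k (w k)].

Lemma measurable_fin_cylinder s E : (forall k, measurable (E k)) ->
  measurable (fin_cylinder s E).
Proof.
move=> mE; elim: s => [|k s ih].
  rewrite (_ : fin_cylinder _ _ = setT); first exact: measurableT.
  by apply/seteqP; split.
rewrite (_ : fin_cylinder _ _ =
  ((fun w : paths R I q => (w k : borel R q)) @^-1` E k) `&` fin_cylinder s E).
  apply: measurableI => //; rewrite -[X in measurable X]setTI.
  exact: measurable_coordinate.
apply/seteqP; split => w /=.
  move=> h; split => [|i si]; apply: h; rewrite inE ?eqxx//.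
  by rewrite si orbT.
by move=> [wk h] i; rewrite inE => /predU1P[->|/h].
Qed.

Definition fin_cylinders : set (set (paths R I q)) :=
  [set C | exists s E,
     [/\ uniq s, forall k, measurable (E k) & C = fin_cylinder s E]].

(** Finite cylinders are stable under intersection and generate the product
    sigma-algebra, so they determine finite measures. *)
Lemma paths_measure_unique (m1 m2 : {measure set (paths R I q) -> \bar R}) :
  (m1 setT < +oo)%E ->
  (forall s E, uniq s -> (forall k, measurable (E k)) ->
    m1 (fin_cylinder s E) = m2 (fin_cylinder s E)) ->
  forall A, measurable A -> m1 A = m2 A.
Proof.
move=> m1oo m12 A; have mcyl C : fin_cylinders C -> measurable C.
  by move=> [s [E [_ mE ->]]]; exact: measurable_fin_cylinder.
have cylT : fin_cylinders setT.
  exists [::], (fun=> setT); split => //.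
  by apply/seteqP; split.
apply: (measure_unique fin_cylinders (fun=> setT)) => //.
- apply/seteqP; split.
    apply: smallest_sub; first exact: smallest_sigma_algebra.
    move=> _ [k [E [mE ->]]]; apply: sub_sigma_algebra.
    exists [:: k], (fun=> E); split => //; apply/seteqP; split => w /=.
      by move=> Ewk i; rewrite inE => /eqP ->.
    by apply; rewrite inE.
  apply: smallest_sub; last exact: mcyl.
  exact: sigma_algebra_measurable.
- move=> _ _ [s [E [us mE ->]]] [t [F [ut mF ->]]].
  exists (undup (s ++ t)), (fun k => (if k \in s then E k else setT) `&`
    (if k \in t then F k else setT)); split; first exact: undup_uniq.
    by move=> k; apply: measurableI; case: ifP.
  apply/seteqP; split => w /=.
    move=> [hs ht] k _; split; case: ifP => //.
      by move=> /hs.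
    by move=> /ht.
  move=> h; split => k ks; have := h k.
    by rewrite mem_undup mem_cat ks/= => /(_ isT)[].
  by rewrite mem_undup mem_cat ks orbT/= => /(_ isT)[].
- by rewrite bigcup_const//; exists 0%N.
- by move=> _ [s [E [us mE ->]]]; exact: m12.
Qed.

Definition update (k : I) (w : I -> 'cV[R]_q) (v : 'cV[R]_q) : I -> 'cV[R]_q :=
  fun i => if i == k then v else w i.

Definition resample (k : I) (z : paths R I q * borel R q) : paths R I q :=
  update k z.1 z.2.

Lemma measurable_resample k : measurable_fun setT (resample k).
Proof.
apply: measurable_paths => i; rewrite /resample /update.
case: (i == k); first exact: measurable_snd.
exact: (measurableT_comp (@measurable_coordinate R I q i) measurable_fst).
Qed.

HB.instance Definition _ k := isMeasurableFun.Build _ _ _ _ (resample k)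
  (measurable_resample k).

Local Open Scope ereal_scope.

Lemma resample_fin_cylinder (P : probability (paths R I q) R)
    (mu : probability (borel R q) R) k s E : uniq s ->
    (forall k, measurable (E k)) ->
  (P \x mu) (resample k @^-1` fin_cylinder s E) =
    P (fin_cylinder (rem k s) E) * (if k \in s then mu (E k) else 1).
Proof.
move=> us mE.
have -> : resample k @^-1` fin_cylinder s E =
    fin_cylinder (rem k s) E `*` (if k \in s then E k else setT).
  apply/seteqP; split => -[w v] /=.
    rewrite /resample/= => h; split.
      move=> i; rewrite mem_rem_uniq// inE => /andP[ik si].
      by have := h i si; rewrite /update (negbTE ik).
    by case: ifP => // ks; have := h k ks; rewrite /update eqxx.
  move=> [h hv] i si; rewrite /resample /update/=.
  case: eqVneq => [ik|ik]; first by move: hv; rewrite -ik si.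
  by apply: h; rewrite mem_rem_uniq// inE ik.
rewrite product_measure1E//; last by case: ifP.
  by case: ifP => // _; congr (_ * _); exact: probability_setT.
exact: measurable_fin_cylinder.
Qed.

(** Both laws give a finite cylinder the product of the probabilities of its
    sides. *)
Lemma resampleE (P : probability (paths R I q) R)
    (mu : probability (borel R q) R) k : independent_coords P ->
  (forall E : set (borel R q), measurable E -> P [set w | E (w k)] = mu E) ->
  forall A, measurable A -> pushforward (P \x mu) (resample k) A = P A.
Proof.
move=> iP Pk; apply: paths_measure_unique.
  by rewrite (le_lt_trans (probability_le1 _ measurableT))// ltry.
move=> s E us mE; rewrite /= /pushforward resample_fin_cylinder//.
rewrite /fin_cylinder (iP (rem k s))//; last exact: rem_uniq.
rewrite (iP s)//; case: ifPn => ks; last by rewrite mule1 rem_id.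
by rewrite (perm_big _ (perm_to_rem ks))/= big_cons muleC Pk.
Qed.

Lemma ge0_integral_resample (P : probability (paths R I q) R)
    (mu : probability (borel R q) R) k (f : paths R I q -> \bar R) :
  independent_coords P ->
  (forall E : set (borel R q), measurable E -> P [set w | E (w k)] = mu E) ->
  measurable_fun [set: paths R I q] f -> (forall w, 0 <= f w) ->
  \int[P]_w f w = \int[P]_w \int[mu]_v f (update k w v).
Proof.
move=> iP Pk mf f0.
transitivity (\int[pushforward (P \x mu) (resample k)]_w f w).
  by apply: eq_measure_integral => A mA _; exact/esym/(resampleE iP Pk mA).
rewrite (ge0_integral_pushforward (measurable_resample k))//.
rewrite preimage_setT fubini_tonelli1//=.
exact: measurableT_comp mf (measurable_resample k).
Qed.

Lemma integral_resample (P : probability (paths R I q) R)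
    (mu : probability (borel R q) R) k (f : paths R I q -> \bar R) :
  independent_coords P ->
  (forall E : set (borel R q), measurable E -> P [set w | E (w k)] = mu E) ->
  P.-integrable setT f ->
  \int[P]_w f w = \int[P]_w \int[mu]_v f (update k w v).
Proof.
move=> iP Pk intf; have mf := measurable_int _ intf.
have mr := measurable_resample k.
have mfr : measurable_fun setT (f \o resample k).
  exact: measurableT_comp mf mr.
have intfr : (P \x mu).-integrable setT (f \o resample k).
  apply/integrableP; split => //; move/integrableP: intf => [_].
  rewrite (ge0_integral_resample iP Pk)//; last exact: measurableT_comp.
  rewrite fubini_tonelli1//.
  by apply: measurableT_comp.
transitivity (\int[pushforward (P \x mu) (resample k)]_w f w).
  by apply: eq_measure_integral => A mA _; exact/esym/(resampleE iP Pk mA).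
rewrite (integral_pushforward mr)// preimage_setT.
by rewrite -integral12_prod_meas1.
Qed.

(** Starting from the point mass at the zero path, resampling one coordinate
    after the other produces any finite product law. *)
Lemma product_law_exists (mu : I -> probability (borel R q) R) (t : seq I) :
  uniq t -> exists P : probability (paths R I q) R,
    independent_coords P /\
    forall k, k \in t -> forall E : set (borel R q), measurable E ->
      P [set w | E (w k)] = mu k E.
Proof.
(* [nu r k] is the law of coordinate [k] once those in [r] are resampled. *)
pose nu (r : seq I) k : probability (borel R q) R :=
  if k \in r then mu k else \d_((0%R : 'cV[R]_q) : borel R q).
suff h (r : seq I) : uniq r -> exists P : probability (paths R I q) R,
    forall s E, uniq s -> (forall k, measurable (E k)) ->
      P (fin_cylinder s E) = \prod_(k <- s) nu r k (E k).
  move=> /h[P PE]; exists P.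
  have P1 k (E : set (borel R q)) : measurable E ->
      P [set w | E (w k)] = nu t k E.
    move=> mE; have := PE [:: k] (fun=> E) isT (fun=> mE).
    rewrite big_seq1 => <-; congr (P _); apply/seteqP; split => w /=.
      by move=> Ew i; rewrite inE => /eqP ->.
    by apply; rewrite inE.
  split; last by move=> k kt E mE; rewrite P1// /nu kt.
  move=> s E us mE; rewrite -[LHS]/(P (fin_cylinder s E)) PE//.
  by apply: eq_bigr => k _; rewrite P1.
elim: r => [|k r ih] /=.
  move=> _; exists \d_((fun=> 0%R : 'cV[R]_q) : paths R I q) => s E us mE.
  elim: s us => [_|k s ih /andP[ks us]].
    rewrite big_nil -[RHS](@probability_setT _ _ _
      (\d_((fun=> 0%R : 'cV[R]_q) : paths R I q) : probability _ _)).
    congr (_ _); by apply/seteqP; split.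
  rewrite big_cons -ih//= /dirac/= !indicE -EFinM; congr (_%:E).
  rewrite -natrM mulnb; congr ((nat_of_bool _)%:R).
  apply/idP/andP.
    rewrite inE /= => h; split; rewrite inE; first by apply: h; exact: mem_head.
    by move=> i si; apply: h; rewrite inE si orbT.
  rewrite !inE => -[h0 h] i; rewrite inE => /predU1P[->//|]; exact: h.
move=> /andP[kr ur]; have [P PE] := ih ur.
exists (distribution (P \x mu k)%E (resample k)) => s E us mE.
rewrite /distribution /pushforward/= resample_fin_cylinder// PE ?rem_uniq//.
have e i : i != k -> nu (k :: r) i = nu r i.
  by move=> ik; rewrite /nu inE (negbTE ik).
case: ifPn => ks; last first.
  rewrite mule1 rem_id//; apply: eq_big_seq => i si; rewrite e//.
  by apply: contraNneq ks => <-.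
rewrite (perm_big _ (perm_to_rem ks))/= big_cons muleC {2}/nu mem_head.
congr (_ * _); apply: eq_big_seq => i.
rewrite mem_rem_uniq// inE => /andP[ik _].
by rewrite e.
Qed.

End resampling.

(** * Means and covariances *)

Section means.
Context (R : realType) d (T : measurableType d) (P : probability T R).

Lemma probability_setC0 (D : set T) :
  measurable D -> P D = 1%E -> P (~` D) = 0%E.
Proof. by move=> mD PD; rewrite probability_setC// PD subee. Qed.

(** Integrability and value of the integral travel together, so that one set of
    rules for sums and products yields both. *)
Definition has_mean (f : T -> R) (e : R) : Prop :=
  P.-integrable setT (EFin \o f) /\ (\int[P]_t (f t)%:E)%E = e%:E.

Lemma has_mean_cst c : has_mean (fun=> c) c.
Proof.
split; first exact: finite_measure_integrable_cst.
rewrite integral_cst// -[RHS]mule1; congr (_ * _)%E.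
exact: probability_setT.
Qed.

Lemma has_meanD f g a b : has_mean f a -> has_mean g b ->
  has_mean (fun t => f t + g t) (a + b).
Proof.
move=> [fi fa] [gi gb]; split.
  by apply: eq_integrable (integrableD measurableT fi gi).
by under eq_integral do rewrite EFinD; rewrite integralD// fa gb.
Qed.

Lemma has_meanZ c f a : has_mean f a -> has_mean (fun t => c * f t) (c * a).
Proof.
move=> [fi fa]; split.
  by apply: eq_integrable (integrableZl measurableT c fi).
by under eq_integral do rewrite EFinM; rewrite integralZl// fa.
Qed.

Lemma has_mean_sum (I : Type) (r : seq I) (p : pred I) (f : I -> T -> R) a :
  (forall i, has_mean (f i) (a i)) ->
  has_mean (fun t => \sum_(i <- r | p i) f i t) (\sum_(i <- r | p i) a i).
Proof.
move=> h; elim: r => [|i r ih].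
  rewrite big_nil (_ : (fun t => _) = fun=> 0); first exact: has_mean_cst.
  by apply/funext => t; rewrite big_nil.
rewrite big_cons (_ : (fun t => _) = fun t => if p i
  then f i t + \sum_(j <- r | p j) f j t else \sum_(j <- r | p j) f j t).
  by case: (p i) => //; apply: has_meanD.
by apply/funext => t; rewrite big_cons.
Qed.

Definition has_mean_mx m n (f : T -> 'M[R]_(m, n)) (e : 'M[R]_(m, n)) : Prop :=
  forall i j, has_mean (fun t => f t i j) (e i j).

Lemma has_mean_mx_ext m n (f g : T -> 'M[R]_(m, n)) e e' : f =1 g -> e = e' ->
  has_mean_mx f e -> has_mean_mx g e'.
Proof. by move=> /funext -> ->. Qed.

Lemma has_mean_mx_cst m n (e : 'M[R]_(m, n)) : has_mean_mx (fun=> e) e.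
Proof. by move=> i j; exact: has_mean_cst. Qed.

Lemma has_mean_mxD m n (f g : T -> 'M[R]_(m, n)) a b :
  has_mean_mx f a -> has_mean_mx g b ->
  has_mean_mx (fun t => f t + g t) (a + b).
Proof.
move=> hf hg i j; rewrite mxE (_ : (fun t => _) = fun t => f t i j + g t i j).
  exact: has_meanD.
by apply/funext => t; rewrite mxE.
Qed.

Lemma has_mean_mx_sum (I : Type) (r : seq I) (p : pred I) m n
    (f : I -> T -> 'M[R]_(m, n)) a :
  (forall i, has_mean_mx (f i) (a i)) ->
  has_mean_mx (fun t => \sum_(i <- r | p i) f i t) (\sum_(i <- r | p i) a i).
Proof.
move=> h i j; rewrite summxE.
rewrite (_ : (fun t => _) = fun t => \sum_(k <- r | p k) f k t i j).
  by apply: has_mean_sum => k; exact: h.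
by apply/funext => t; rewrite summxE.
Qed.

Lemma has_mean_mulmxl m n p (A : 'M[R]_(p, m)) (f : T -> 'M[R]_(m, n)) a :
  has_mean_mx f a -> has_mean_mx (fun t => A *m f t) (A *m a).
Proof.
move=> h i j; rewrite mxE.
rewrite (_ : (fun t => _) = fun t => \sum_k A i k * f t k j).
  by apply: has_mean_sum => k; exact/has_meanZ/h.
by apply/funext => t; rewrite mxE.
Qed.

Lemma has_mean_trmx m n (f : T -> 'M[R]_(m, n)) a :
  has_mean_mx f a -> has_mean_mx (fun t => (f t)^T) a^T.
Proof.
move=> h i j; rewrite mxE (_ : (fun t => _) = fun t => f t j i); first exact: h.
by apply/funext => t; rewrite mxE.
Qed.

Lemma has_mean_mulmxr m n p (A : 'M[R]_(n, p)) (f : T -> 'M[R]_(m, n)) a :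
  has_mean_mx f a -> has_mean_mx (fun t => f t *m A) (a *m A).
Proof.
move=> /has_mean_trmx/(has_mean_mulmxl A^T)/has_mean_trmx.
by apply: has_mean_mx_ext => [t|]; rewrite trmx_mul !trmxK.
Qed.

Lemma has_mean_mxtrace n (f : T -> 'M[R]_n) a :
  has_mean_mx f a -> has_mean (fun t => \tr (f t)) (\tr a).
Proof. by move=> h; apply: has_mean_sum => i; exact: h. Qed.

(** The cross terms of [quad W y = tr (W y y^T)] have zero mean: only the
    squares of the uncorrelated centred vectors [xi j] contribute. *)
Lemma has_mean_quad (I : finType) n q (W : 'M[R]_n) (c : 'cV[R]_n)
    (L : I -> 'M[R]_(n, q)) (S : I -> 'M[R]_q) (xi : I -> T -> 'cV[R]_q) :
  (forall j, has_mean_mx (xi j) 0) ->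
  (forall j l, has_mean_mx (fun t => xi j t *m (xi l t)^T)
    (if j == l then S j else 0)) ->
  has_mean (fun t => quad W (c + \sum_j L j *m xi j t))
    (quad W c + \sum_j \tr ((L j)^T *m W *m L j *m S j)).
Proof.
move=> m1 m2.
have lin : has_mean_mx (fun t => \sum_j L j *m xi j t) 0.
  have := @has_mean_mx_sum _ (index_enum I) xpredT _ _ _ (fun j => L j *m 0)
    (fun j => has_mean_mulmxl (L j) (m1 j)).
  by apply: has_mean_mx_ext => //; rewrite big1// => j _; rewrite mulmx0.
have sq : has_mean_mx
    (fun t => (\sum_j L j *m xi j t) *m (\sum_j L j *m xi j t)^T)
    (\sum_j L j *m S j *m (L j)^T).
  have h : has_mean_mx (fun t => \sum_j \sum_l
      L j *m (xi j t *m (xi l t)^T) *m (L l)^T)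
      (\sum_j \sum_l L j *m (if j == l then S j else 0) *m (L l)^T).
    apply: has_mean_mx_sum => j; apply: has_mean_mx_sum => l.
    exact/has_mean_mulmxr/has_mean_mulmxl.
  apply: has_mean_mx_ext h => [t|].
    rewrite mulmx_suml; apply: eq_bigr => j _.
    rewrite linear_sum mulmx_sumr; apply: eq_bigr => l _.
    by rewrite /= trmx_mul !mulmxA.
  apply: eq_bigr => j _; rewrite (bigD1 j)//= eqxx big1 ?addr0// => l lj.
  by rewrite eq_sym (negbTE lj) mulmx0 mul0mx.
have h : has_mean_mx (fun t => (c + \sum_j L j *m xi j t) *m
    (c + \sum_j L j *m xi j t)^T) (c *m c^T + \sum_j L j *m S j *m (L j)^T).
  have := has_mean_mxD (has_mean_mxD (has_mean_mx_cst (c *m c^T))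
    (has_mean_mulmxl c (has_mean_trmx lin)))
    (has_mean_mxD (has_mean_mulmxr c^T lin) sq).
  apply: has_mean_mx_ext => [t|].
    by rewrite [(c + _)^T]linearD/= mulmxDl !mulmxDr.
  by rewrite trmx0 mulmx0 mul0mx addr0 add0r.
have := has_mean_mxtrace (has_mean_mulmxl W h).
rewrite (_ : (fun t => _) = fun t => quad W (c + \sum_j L j *m xi j t)).
  rewrite mulmxDr linearD/= mxtrace_outer mulmx_sumr linear_sum/=.
  rewrite (eq_bigr (fun j => \tr ((L j)^T *m W *m L j *m S j)))// => j _.
  by rewrite !mulmxA mxtrace_mulC !mulmxA.
by apply/funext => t; rewrite mxtrace_outer.
Qed.

Lemma has_mean_bounded (D : set T) (f : T -> R) c : measurable D ->
  P D = 1%E -> measurable_fun setT f -> (forall t, D t -> `|f t| <= c) ->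
  exists2 e, has_mean f e & `|e| <= c.
Proof.
move=> mD PD mf fc.
have c0 : 0 <= c.
  have [t Dt] : D !=set0.
    apply/set0P/negP => /eqP D0; move: PD; rewrite D0 measure0 => -[] /eqP.
    by rewrite eq_sym oner_eq0.
  exact: le_trans (fc t Dt).
have PN := probability_setC0 mD PD.
have mef : measurable_fun setT (EFin \o f) by exact/measurable_EFinP.
have fle : (\int[P]_t `|(EFin \o f) t| <= c%:E)%E.
  apply: (@le_trans _ _ (\int[P]_t (cst c%:E t))%E); last first.
    rewrite integral_cst//= -[leRHS]mule1; apply: lee_wpmul2l => //.
    exact: probability_le1.
  apply: ae_ge0_le_integral => //.
  - by apply: measurableT_comp.
  - exists (~` D); split => //; first exact: measurableC.
    by move=> t /= h Dt; apply: h => _; rewrite lee_fin; exact: fc.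
have intf : P.-integrable setT (EFin \o f).
  by apply/integrableP; split => //; rewrite (le_lt_trans fle)// ltry.
have fin := integrable_fin_num measurableT intf.
exists (fine (\int[P]_t (EFin \o f) t)%E).
  by split => //; rewrite fineK.
by rewrite -lee_fin -abse_EFin fineK// (le_trans (le_abse_integral P _ mef)).
Qed.

End means.

Lemma has_mean_marginal (R : realType) (I : Type) q
    (P : probability (paths R I q) R) (mu : probability (borel R q) R) k :
  (forall E : set (borel R q), measurable E -> P [set w | E (w k)] = mu E) ->
  forall (g : 'cV[R]_q -> R) e, has_mean mu (g : borel R q -> R) e ->
  has_mean P (fun w => g (w k)) e.
Proof.
move=> Pk g e [gi ge].
pose X (w : paths R I q) : borel R q := w k.
have mX : measurable_fun setT X := @measurable_coordinate R I q k.
have PX (f : borel R q -> \bar R) :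
    (\int[pushforward P X]_v f v = \int[mu]_v f v)%E.
  by apply: eq_measure_integral => A mA _; exact: Pk.
have mg : measurable_fun setT (EFin \o g : borel R q -> \bar R).
  exact: measurable_int gi.
have iX : P.-integrable (X @^-1` setT) ((EFin \o (g : borel R q -> R)) \o X).
  rewrite preimage_setT; apply/integrableP.
  split; first exact: measurableT_comp.
  move/integrableP : gi => [_]; rewrite -PX (ge0_integral_pushforward mX)//.
  by apply: measurableT_comp.
split; first by move: iX; rewrite preimage_setT.
have := integral_pushforward mX mg iX measurableT.
by rewrite PX ge preimage_setT => <-.
Qed.

Section disturbance_moments.
Context (R : realType) (q : nat) (W : set 'cV[R]_q).
Hypotheses (cW : closed W) (bW : bounded_set W).

Lemma bounded_set_entries :
  exists c : R, forall w, W w -> forall i, `|w i ord0| <= c.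
Proof.
have /ex_strict_bound_gt0[c c0 Wc] := bW.
exists c => w Ww i; rewrite (le_trans (entry_le_norm w i ord0))//.
exact/ltW/Wc.
Qed.

Lemma closed_borel n (A : set 'cV[R]_n) : closed A ->
  measurable (A : set (borel R n)).
Proof.
move=> cA; rewrite -[A]setCK; apply: measurableC.
by apply: sub_sigma_algebra; exact: closed_openC.
Qed.

Lemma second_moment_bound (mu : probability (borel R q) R) c :
  (forall w, W w -> forall i, `|w i ord0| <= c) -> mu W = 1%E ->
  forall i j, exists2 e, has_mean mu (fun w : borel R q =>
    (w : 'cV[R]_q) i ord0 * (w : 'cV[R]_q) j ord0) e & `|e| <= c * c.
Proof.
move=> Wc muW i j.
apply: (has_mean_bounded (closed_borel cW) muW).
- by apply: measurable_funM; exact: measurable_entry.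
- by move=> w Ww; rewrite normrM ler_pM//; exact: Wc.
Qed.

Lemma zero_mean_onP (mu : probability (borel R q) R) (S : 'M[R]_q) :
  zero_mean_on W mu -> second_moment mu S ->
  has_mean_mx mu (fun w : borel R q => (w : 'cV[R]_q)) 0 /\
  has_mean_mx mu (fun w : borel R q => (w : 'cV[R]_q) *m (w : 'cV[R]_q)^T) S.
Proof.
move=> [muW mu0] muS; split => i j.
  have [iw] := mu0 i; rewrite unlock => e.
  by rewrite (ord1 j) mxE; split.
rewrite (_ : (fun w => _) = fun w : borel R q =>
    (w : 'cV[R]_q) i ord0 * (w : 'cV[R]_q) j ord0); last first.
  by apply/funext => w; rewrite mxE big_ord1 mxE.
have [c Wc] := bounded_set_entries.
have [e [ie _] _] := second_moment_bound Wc muW i j; split => //.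
by have := muS i j; rewrite unlock.
Qed.

(** Distinct coordinates are uncorrelated: resampling coordinate [j] averages
    the factor [w j] to its zero mean while [w l] stays fixed. *)
Lemma independent_moments (I : eqType) (P : probability (paths R I q) R)
    (S : I -> 'M[R]_q) (mu : I -> probability (borel R q) R) :
  independent_coords P ->
  (forall k, zero_mean_on W (mu k)) -> (forall k, second_moment (mu k) (S k)) ->
  (forall k (E : set (borel R q)), measurable E ->
    P [set w | E (w k)] = mu k E) ->
  (forall k, has_mean_mx P (fun w : paths R I q => w k) 0) /\
  (forall j l, has_mean_mx P (fun w : paths R I q => w j *m (w l)^T)
    (if j == l then S j else 0)).
Proof.
move=> iP mu0 muS Pk.
have mom k := zero_mean_onP (mu0 k) (muS k).
have m1 k : has_mean_mx P (fun w : paths R I q => w k) 0.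
  move=> a b; exact: (has_mean_marginal (Pk k) (g := fun v : 'cV_q => v a b)
    ((mom k).1 a b)).
split => // j l; case: eqVneq => [<-|jl] a b.
  exact: (has_mean_marginal (Pk j) (g := fun v : 'cV_q => (v *m v^T) a b)
    ((mom j).2 a b)).
rewrite mxE (_ : (fun w => _) = fun w : paths R I q =>
    w j a ord0 * w l b ord0); last first.
  by apply/funext => w; rewrite mxE big_ord1 mxE.
have sq k c : has_mean P (fun w : paths R I q => w k c ord0 ^+ 2) (S k c c).
  have := has_mean_marginal (Pk k) (g := fun v : 'cV_q => (v *m v^T) c c)
    ((mom k).2 c c).
  rewrite (_ : (fun w => _) = fun w : paths R I q => w k c ord0 ^+ 2)//.
  by apply/funext => w; rewrite mxE big_ord1 mxE expr2.
have mc k c : measurable_fun setT (fun w : paths R I q => w k c ord0).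
  exact: (measurableT_comp (@measurable_entry R q c)
    (@measurable_coordinate R I q k)).
have intjl : P.-integrable setT
    (EFin \o (fun w : paths R I q => w j a ord0 * w l b ord0)).
  have [isq _] := has_meanD (sq j a) (sq l b).
  apply: le_integrable isq => //.
    by apply/measurable_EFinP; exact: measurable_funM.
  move=> w _ /=; set x := w j a ord0; set y := w l b ord0.
  rewrite lee_fin [leRHS]ger0_norm; last by rewrite addr_ge0// sqr_ge0.
  by rewrite ler_norml; apply/andP; split; nra.
split => //.
rewrite (integral_resample iP (Pk j) intjl)/=.
rewrite (eq_integral (fun=> 0%E)); first by rewrite integral0.
move=> w _; have [iv v0] := (mom j).1 a ord0.
under eq_integral do rewrite /update eqxx eq_sym (negbTE jl) EFinM.
by rewrite integralZr// v0 mxE mul0e.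
Qed.

End disturbance_moments.

(** * Compactness of the covariance ball *)

Lemma closed_psd (R : realType) (T : topologicalType) n (f : T -> 'M[R]_n) :
  continuous f -> closed [set x | psd (f x)].
Proof.
move=> cf; rewrite (_ : [set x | _] = [set x | (f x)^T - f x = 0] `&`
    \bigcap_(y in [set: 'cV[R]_n]) [set x | 0 <= quad (f x) y]).
  apply: closedI.
    apply: closed_eq0_mx => x; apply: cvgB; last exact: cf.
    exact: continuous_trmx.
  apply: closed_bigI => y _; apply: closed_ge_fun.
  by apply: continuous_quad => //; exact: cst_continuous.
apply/seteqP; split => x /=.
  by move=> [ft f0]; split; [rewrite ft subrr|move=> y _; exact: f0].
move=> [ft f0]; split; first by apply/eqP; rewrite -subr_eq0; exact/eqP.
by move=> y; exact: f0.
Qed.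

(** At the centre, [s (s s) s = (s s) (s s)]: the inner square root is the
    centre itself and the distance vanishes. *)
Lemma cov_ball_center (R : realType) q (d : ambiguity R q) :
  psd d.2 -> cov_ball d d.2.
Proof.
move=> pd; split => //; have [ps ss] := psd_sqrtP pd.
rewrite [psd_sqrt (_ *m _ *m _)](@psd_sqrt_eq _ _ _ d.2)//.
  by rewrite -mulr2n -scaler_nat subrr linear0 sqr_ge0.
by move: ss; set s := psd_sqrt _ => <-; rewrite !mulmxA.
Qed.

(** The square root in the definition of the ball is traded for a second matrix
    [T] with [T^2 = s S s]: the resulting set of pairs [(S, T)] is closed by
    inspection and bounded, since [W] bounds the entries of [S] and
    [tr T^2 = tr (s S s)] those of [T]. *)
Lemma cov_ball_max (R : realType) q (W : set 'cV[R]_q) (d : ambiguity R q)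
    (H : 'M[R]_q) : closed W -> bounded_set W -> admissible_amb W d ->
  exists2 S, cov_ball d S &
    forall S', cov_ball d S' -> \tr (H *m S') <= \tr (H *m S).
Proof.
move=> cW bW [e0 pd adm].
have [c Wc] := bounded_set_entries bW.
have Sbound S i j : cov_ball d S -> `|S i j| <= c * c.
  move=> /adm[mu [muW _] muS].
  have [e [_ ie] eb] := second_moment_bound cW Wc muW i j.
  by have := muS i j; rewrite unlock ie => -[<-].
pose s := psd_sqrt d.2.
have [ps ss] := psd_sqrtP pd; rewrite -/s in ps ss.
pose b := 1 + \sum_i \sum_j `|d.2 i j| * (c * c).
pose K : set ('M[R]_q * 'M[R]_q) := [set z | psd z.1] `&` [set z | psd z.2] `&`
  [set z | z.2 *m z.2 - s *m z.1 *m s = 0] `&`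
  [set z | \tr (d.2 + z.1 - 2%:R *: z.2) <= d.1 ^+ 2].
have KP S : cov_ball d S <-> exists T, K (S, T).
  split.
    move=> [pS St]; have pX : psd (s *m S *m s).
      by rewrite -{1}(psd_tr ps); exact: psd_conj.
    have [pT TT] := psd_sqrtP pX.
    exists (psd_sqrt (s *m S *m s)).
    by split => //; split; [split|rewrite /= TT subrr].
  move=> [T [[[/= pS pT] TT] trT]]; split => //.
  rewrite -/s (@psd_sqrt_eq _ _ _ T)//.
  by apply/eqP; rewrite -subr_eq0; exact/eqP.
have c1 : continuous (fst : 'M[R]_q * 'M[R]_q -> 'M[R]_q).
  by move=> z; exact: cvg_fst.
have c2 : continuous (snd : 'M[R]_q * 'M[R]_q -> 'M[R]_q).
  by move=> z; exact: cvg_snd.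
have ccst (T : topologicalType) (M : 'M[R]_q) : continuous (fun _ : T => M).
  exact: cst_continuous.
have cK : compact K.
  have cB := compact_setX (@compact_box R q q (c * c)) (@compact_box R q q b).
  apply: (subclosed_compact _ cB).
  - apply: closedI; last first.
      apply/closed_le_fun/continuous_mxtrace => z.
      apply: cvgB; last by apply: cvgZr; exact: c2.
      by apply: cvgD; [exact: cvg_cst|exact: c1].
    apply: closedI; last first.
      apply: closed_eq0_mx => z; apply: cvgB.
        exact: (continuous_mulmx c2 c2).
      exact: (continuous_mulmx (continuous_mulmx (ccst _ s) c1) (ccst _ s)).
    by apply: closedI; exact: closed_psd.
  - move=> [S T] KST; split => /= i j.
      by apply: Sbound; apply/KP; exists T.
    have bS : cov_ball d S by apply/KP; exists T.
    move: KST => [[[/= pS [Tt _]] TT] _].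
    have TTe : T *m T = s *m S *m s.
      by apply/eqP; rewrite -subr_eq0; exact/eqP.
    have trb : \sum_k \sum_l T k l ^+ 2 <= b - 1.
      have -> : \sum_k \sum_l T k l ^+ 2 = \tr (d.2 *m S).
        transitivity (\tr (T *m T^T)).
          apply: eq_bigr => k _; rewrite mxE; apply: eq_bigr => l _.
          by rewrite mxE expr2.
        by rewrite Tt TTe mxtrace_mulC mulmxA ss.
      rewrite /b addrC addKr; apply: ler_sum => k _; rewrite mxE.
      apply: ler_sum => l _; rewrite (le_trans (ler_norm _))// normrM.
      by rewrite ler_wpM2l// Sbound.
    have : T i j ^+ 2 <= b - 1.
      apply: le_trans trb; rewrite (bigD1 i)//= (bigD1 j)//= -addrA lerDl.
      rewrite addr_ge0 ?sumr_ge0// => k _; first exact: sqr_ge0.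
      by rewrite sumr_ge0// => l _; exact: sqr_ge0.
    by rewrite ler_norml => h; apply/andP; split; nra.
have [T0 KT0] := (KP d.2).1 (cov_ball_center pd).
have [[S T]] := @compact_EVT_max _ R (fun z => \tr (H *m z.1)) K
  (ex_intro _ _ KT0) cK (continuous_subspaceT
    (continuous_mxtrace (continuous_mulmx (ccst _ H) c1))).
rewrite inE => KST Smax; exists S; first by apply/KP; exists T.
move=> S' /KP[T' KST']; exact: (Smax (S', T') (mem_set KST')).
Qed.

(** * Affine trajectories and the shifted policy *)

Section affine_trajectories.
Context (R : realType) (n m q : nat) (sys : mpc R n m q).
Local Notation N := (horizon sys).
Implicit Types (x : 'cV[R]_n) (th : policy sys) (w : 'I_N -> 'cV[R]_q).

(** Feedback blocks for all natural indices, zero off the causal range, so that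
    indices can be shifted without range conditions. *)
Definition feedback th (k j : nat) : 'M[R]_(m, q) :=
  if (j < k)%N then oapp (fun i => oapp (th.1 i) 0 (insub j)) 0 (insub k)
  else 0.

(** The matrix with which the disturbance at time [j] enters the state at time
    [k]. *)
Fixpoint gain th (k j : nat) : 'M[R]_(n, q) :=
  if k is i.+1 then mA sys *m gain th i j + mB sys *m feedback th i j +
    (if j == i then mG sys else 0)
  else 0.

(** The state in the absence of disturbances. *)
Fixpoint nominal x th (k : nat) : 'cV[R]_n :=
  if k is i.+1 then mA sys *m nominal x th i + mB sys *m at_time th.2 i else x.

Lemma gainS th i j : gain th i.+1 j = mA sys *m gain th i j +
  mB sys *m feedback th i j + (if j == i then mG sys else 0).
Proof. by []. Qed.

Lemma nominalS x th i :
  nominal x th i.+1 = mA sys *m nominal x th i + mB sys *m at_time th.2 i.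
Proof. by []. Qed.

Lemma at_time_ord (V : nmodType) M (f : 'I_M -> V) (i : 'I_M) :
  at_time f i = f i.
Proof. by rewrite /at_time valK. Qed.

Lemma at_time_out (V : nmodType) M (f : 'I_M -> V) k : (M <= k)%N ->
  at_time f k = 0.
Proof. by move=> Mk; rewrite /at_time insubF// ltnNge Mk. Qed.

Lemma feedback_ge th k j : (k <= j)%N -> feedback th k j = 0.
Proof. by move=> kj; rewrite /feedback ltnNge kj. Qed.

Lemma feedback_ord th (i j : 'I_N) : (j < i)%N -> feedback th i j = th.1 i j.
Proof. by move=> ji; rewrite /feedback ji !valK. Qed.

Lemma gain_ge th k j : (k <= j)%N -> gain th k j = 0.
Proof.
elim: k => //= k ih kj; rewrite ih ?(ltnW kj)// feedback_ge ?(ltnW kj)//.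
by rewrite !mulmx0 !addr0 add0r ifF// gtn_eqF.
Qed.

Lemma inputE th w k : at_time (input th w) k =
  at_time th.2 k + \sum_(j < N) feedback th k j *m w j.
Proof.
have [kN|Nk] := ltnP k N; last first.
  rewrite !at_time_out// add0r big1// => j _.
  by rewrite /feedback (@insubF _ _ _ k) ?ltnNge ?Nk// if_same mul0mx.
rewrite -[k]/(val (Ordinal kN)) !at_time_ord /input; congr (_ + _).
rewrite big_mkcond; apply: eq_bigr => j _.
case: ifPn => jk; first by rewrite feedback_ord.
by rewrite feedback_ge ?mul0mx// leqNgt.
Qed.

Lemma stateE x th w k : state x th w k =
  nominal x th k + \sum_(j < N) gain th k j *m w j.
Proof.
elim: k => [|k ih] /=.
  by rewrite big1 ?addr0// => j _; rewrite mul0mx.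
rewrite /step ih inputE !mulmxDr.
have -> : mG sys *m at_time w k =
    \sum_(j < N) (if j == k :> nat then mG sys else 0) *m w j.
  have [kN|Nk] := ltnP k N; last first.
    rewrite at_time_out// mulmx0 big1// => j _.
    by rewrite ifF ?mul0mx// ltn_eqF// (leq_trans _ Nk).
  rewrite (bigD1 (Ordinal kN))//= eqxx big1 ?addr0; last first.
    by move=> j jk; rewrite ifF ?mul0mx//; exact/negbTE.
  by rewrite -[k]/(val (Ordinal kN)) at_time_ord.
under [in RHS]eq_bigr do rewrite !mulmxDl.
rewrite !big_split/= !mulmx_sumr -!addrA.
under [in RHS]eq_bigr do rewrite -mulmxA.
under [X in _ = _ + (_ + (_ + (X + _)))]eq_bigr do rewrite -mulmxA.
by congr (_ + _); rewrite addrCA; congr (_ + _); rewrite !addrA.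
Qed.

(** The policy for the next instant: the tail of [th] with the observed
    disturbance [w0] substituted, followed by the terminal feedback [Kf] applied
    to the predicted final state. Only the offsets depend on [w0], not the
    feedback blocks. *)
Definition shift_policy (Kf : 'M[R]_(m, n)) x th (w0 : 'cV[R]_q) : policy sys :=
  (fun i j : 'I_N => if (i.+1 < N)%N then feedback th i.+1 j.+1
     else Kf *m gain th N j.+1,
   fun i : 'I_N => if (i.+1 < N)%N
     then at_time th.2 i.+1 + feedback th i.+1 0 *m w0
     else Kf *m (nominal x th N + gain th N 0 *m w0)).

Section shift.
Variables (Kf : 'M[R]_(m, n)) (x : 'cV[R]_n) (th : policy sys) (w0 : 'cV[R]_q).
Hypothesis N0 : (0 < N)%N.
Let th' := shift_policy Kf x th w0.
Let x' := step sys x (at_time th.2 0) w0.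

Lemma feedback_shift i j : (i < N)%N -> feedback th' i j =
  if (i.+1 < N)%N then feedback th i.+1 j.+1 else Kf *m gain th N j.+1.
Proof.
move=> iN; have [ji|ij] := ltnP j i; last first.
  rewrite feedback_ge//; case: ifPn => h; first by rewrite feedback_ge.
  by rewrite gain_ge ?mulmx0// (leq_trans _ (_ : i < j.+1)%N)// leqNgt.
have jN := ltn_trans ji iN.
by rewrite -[i]/(val (Ordinal iN)) -[j]/(val (Ordinal jN)) feedback_ord.
Qed.

Lemma at_time_shift i : (i < N)%N -> at_time th'.2 i =
  if (i.+1 < N)%N then at_time th.2 i.+1 + feedback th i.+1 0 *m w0
  else Kf *m (nominal x th N + gain th N 0 *m w0).
Proof. by move=> iN; rewrite -[i]/(val (Ordinal iN)) at_time_ord. Qed.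

Lemma causal_shift : causal th'.
Proof.
move=> i j ij /=; case: ifPn => h; first by rewrite feedback_ge.
by rewrite gain_ge ?mulmx0// (leq_trans _ (_ : i < j.+1)%N)// leqNgt.
Qed.

Lemma gain_shift k j : (k < N)%N -> gain th' k j = gain th k.+1 j.+1.
Proof.
elim: k => [|k ih] kN.
  by rewrite /= (@feedback_ge _ 0)// !mulmx0 !addr0.
by rewrite gainS ih ?(ltnW kN)// feedback_shift ?(ltnW kN)// kN.
Qed.

Lemma nominal_shift k : (k < N)%N ->
  nominal x' th' k = nominal x th k.+1 + gain th k.+1 0 *m w0.
Proof.
elim: k => [|k ih] kN.
  by rewrite /= (@feedback_ge _ 0)// !mulmx0 !add0r.
rewrite nominalS ih ?(ltnW kN)// at_time_shift ?(ltnW kN)// kN.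
rewrite [nominal x th k.+2]nominalS [gain th k.+2 0]gainS addr0.
move: (nominal x th k.+1) (gain th k.+1 0) => a g.
by rewrite !mulmxDr mulmxDl -!mulmxA addrACA.
Qed.

Lemma gain_shiftN j : gain th' N j = (mA sys + mB sys *m Kf) *m gain th N j.+1 +
  (if j.+1 == N then mG sys else 0).
Proof.
case EN : N N0 => [//|k] _; rewrite gainS -EN -(inj_eq succn_inj) -[k.+1]EN.
have kN : (k < N)%N by rewrite EN.
by rewrite gain_shift// feedback_shift// -EN ltnn mulmxDl mulmxA EN.
Qed.

Lemma nominal_shiftN : nominal x' th' N =
  (mA sys + mB sys *m Kf) *m (nominal x th N + gain th N 0 *m w0).
Proof.
case EN : N N0 => [//|k] _; rewrite nominalS.
have kN : (k < N)%N by rewrite EN.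
by rewrite nominal_shift// at_time_shift// -EN ltnn mulmxDl mulmxA EN.
Qed.

Definition prepend (v : 'cV[R]_q) w : 'I_N -> 'cV[R]_q :=
  fun i => if val i is k.+1 then at_time w k else v.

(** Prepending drops the last disturbance; its weight on the right is [f N]. *)
Lemma sum_prepend p (f : nat -> 'M[R]_(p, q)) w : f N = 0 ->
  \sum_(j < N) f j *m prepend w0 w j =
  f 0%N *m w0 + \sum_(j < N) f j.+1 *m w j.
Proof.
rewrite /prepend; move: w; case: N N0 => [//|M] _ w fN.
rewrite big_ord_recl/=; congr (_ + _).
rewrite big_ord_recr/= fN mul0mx addr0; apply: eq_bigr => j _.
by rewrite -[X in at_time _ X]/(val (widen_ord (leqnSn M) j)) at_time_ord.
Qed.

Lemma state_shift w k : (k < N)%N ->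
  state x' th' w k = state x th (prepend w0 w) k.+1.
Proof.
move=> kN; rewrite !stateE sum_prepend//; last exact: gain_ge.
rewrite addrA nominal_shift//.
by under eq_bigr do rewrite gain_shift//.
Qed.

Lemma input_shift w k : (k < N)%N -> at_time (input th' w) k =
  if (k.+1 < N)%N then at_time (input th (prepend w0 w)) k.+1
  else Kf *m state x th (prepend w0 w) N.
Proof.
move=> kN; rewrite inputE at_time_shift//.
under eq_bigr do rewrite feedback_shift//.
case: ifPn => h.
  rewrite inputE sum_prepend//; last exact: feedback_ge (ltnW h).
  by rewrite addrA.
rewrite stateE sum_prepend//; last exact: gain_ge.
rewrite addrA [RHS]mulmxDr mulmx_sumr.
by under [in RHS]eq_bigr do rewrite mulmxA.
Qed.

Lemma state_shiftN w : exists2 k : 'I_N, k.+1 = N &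
  state x' th' w N = (mA sys + mB sys *m Kf) *m
    state x th (prepend w0 w) N + mG sys *m w k.
Proof.
have kN : (N.-1 < N)%N by rewrite prednK.
exists (Ordinal kN); first by rewrite /= prednK.
rewrite -{1}(prednK N0) [LHS]/= /step state_shift// input_shift// prednK// ltnn.
by rewrite mulmxDl -mulmxA -[X in at_time _ X]/(val (Ordinal kN)) at_time_ord.
Qed.

End shift.

(** The shifted policy reproduces the trajectories of [th] that begin with the
    disturbance [w0]; its last step stays in the terminal set by the assumption
    on [Kf]. *)
Lemma feasible_shift Kf x th (w0 : 'cV[R]_q) : (0 < N)%N ->
  (forall x (w : 'cV[R]_q), Xfset sys x -> Wset sys w ->
     Zset sys (x, Kf *m x) /\
     Xfset sys ((mA sys + mB sys *m Kf) *m x + mG sys *m w)) ->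
  feasible_policy sys x th -> Wset sys w0 ->
  feasible_policy sys (step sys x (at_time th.2 0) w0)
    (shift_policy Kf x th w0).
Proof.
move=> N0 term [cth fth] Ww0; split; first exact: causal_shift.
move=> w Ww.
have Wp k : Wset sys (prepend w0 w k).
  rewrite /prepend; case Ek : (val k) => [//|i].
  have iN : (i.+1 < N)%N by rewrite -Ek; exact: ltn_ord.
  by rewrite -[i]/(val (Ordinal (ltnW iN))) at_time_ord.
have [fZ fX] := fth _ Wp; split; last first.
  have [k _ ->] := state_shiftN Kf x th w0 N0 w.
  exact: (term _ _ fX (Ww k)).2.
move=> k; rewrite -[input _ w k]at_time_ord input_shift// state_shift//.
case: ifPn => h.
  by have := fZ (Ordinal h); rewrite -[input _ _ (Ordinal h)]at_time_ord.
have -> : k.+1 = N by apply/eqP; rewrite eqn_leq ltn_ord/= leqNgt.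
exact: (term _ _ fX (Ww k)).1.
Qed.

End affine_trajectories.

(** * Expected costs *)

(** The expectation of [quad W (c + sum_j L j w_j)] for uncorrelated centred
    [w_j] with covariances [S j]. *)
Definition mean_quad (R : realType) p q (N : nat) (W : 'M[R]_p) (c : 'cV[R]_p)
    (L : nat -> 'M[R]_(p, q)) (S : nat -> 'M[R]_q) : R :=
  quad W c + \sum_(j < N) \tr ((L j)^T *m W *m L j *m S j).

(** Covariances for a disturbance sequence that starts one step earlier. *)
Definition prepend_cov (R : realType) q (s : 'M[R]_q) (S : nat -> 'M[R]_q) :
    nat -> 'M[R]_q :=
  fun j => if j is i.+1 then S i else s.

Section expected_quadratic.
Context (R : realType) (p q : nat).
Implicit Types (W : 'M[R]_p) (c : 'cV[R]_p) (L : nat -> 'M[R]_(p, q))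
  (S : nat -> 'M[R]_q).

Lemma mean_quadD N W1 W2 c L S :
  mean_quad N (W1 + W2) c L S = mean_quad N W1 c L S + mean_quad N W2 c L S.
Proof.
rewrite /mean_quad quadDl addrACA -big_split/=; congr (_ + _).
by apply: eq_bigr => j _; rewrite mulmxDr !mulmxDl linearD.
Qed.

Lemma mean_quadN N W c L S : mean_quad N (- W) c L S = - mean_quad N W c L S.
Proof.
rewrite /mean_quad quadNl opprD -sumrN; congr (_ + _).
by apply: eq_bigr => j _; rewrite mulmxN !mulNmx linearN.
Qed.

Lemma mean_quad_conj N p' (W : 'M[R]_p') (K : 'M[R]_(p', p)) c L S :
  mean_quad N W (K *m c) (fun j => K *m L j) S =
  mean_quad N (K^T *m W *m K) c L S.
Proof.
rewrite /mean_quad quad_mulmx; congr (_ + _); apply: eq_bigr => j _.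
by rewrite trmx_mul !mulmxA.
Qed.

Lemma mean_quad_ge0 N W c L S : psd W -> (forall j, psd (S j)) ->
  0 <= mean_quad N W c L S.
Proof.
move=> pW pS; apply: addr_ge0; first by case: pW.
by apply: sumr_ge0 => j _; apply: psd_trace_mul_ge0 => //; exact: psd_conj.
Qed.

Lemma mean_quad_gain0 N W c L S :
  (forall j, L j = 0) -> mean_quad N W c L S = quad W c.
Proof.
move=> L0; rewrite /mean_quad big1 ?addr0// => j _.
by rewrite L0 mulmx0 mul0mx linear0.
Qed.

(** After averaging, [w] counts as one more uncorrelated disturbance, with
    covariance [S0]. The last of the shifted gains, [L N], falls outside the
    range of the resulting sum. *)
Lemma mean_quad_average N (mu : probability (borel R q) R)
    (S0 : 'M[R]_q) W c L S :
  has_mean_mx mu (fun w : borel R q => (w : 'cV[R]_q)) 0 ->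
  has_mean_mx mu (fun w : borel R q => (w : 'cV[R]_q) *m (w : 'cV[R]_q)^T) S0 ->
  (0 < N)%N -> L N = 0 ->
  has_mean mu (fun w : borel R q =>
      mean_quad N W (c + L 0%N *m (w : 'cV[R]_q)) (fun j => L j.+1) S)
    (mean_quad N W c L (prepend_cov S0 S)).
Proof.
move=> m1 m2 N0 LN.
have h := @has_mean_quad _ _ _ mu 'I_1 _ _ W c (fun=> L 0%N) (fun=> S0)
  (fun _ (w : borel R q) => (w : 'cV[R]_q)) (fun=> m1).
have /h{}h (j l : 'I_1) : has_mean_mx mu
    (fun t : borel R q => (t : 'cV[R]_q) *m (t : 'cV[R]_q)^T)
    (if j == l then S0 else 0) by rewrite !ord1 eqxx.
have := has_meanD h (has_mean_cst mu
  (\sum_(j < N) \tr ((L j.+1)^T *m W *m L j.+1 *m S j))).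
rewrite (_ : (fun t => _) = fun w : borel R q =>
  mean_quad N W (c + L 0%N *m (w : 'cV[R]_q)) (fun j => L j.+1) S); last first.
  by apply/funext => w; rewrite big_ord1.
rewrite (_ : _ + _ = mean_quad N W c L (prepend_cov S0 S))//.
rewrite /mean_quad -addrA big_ord1; congr (_ + _).
case: N N0 LN => [//|M] _ LN; rewrite [RHS]big_ord_recl/=; congr (_ + _).
by rewrite big_ord_recr/= LN mulmx0 mul0mx linear0 addr0.
Qed.

End expected_quadratic.

Section expected_cost.
Context (R : realType) (n m q : nat) (sys : mpc R n m q).
Local Notation N := (horizon sys).
Implicit Types (x : 'cV[R]_n) (th : policy sys) (S : nat -> 'M[R]_q).

Definition nominal_cost x th : R :=
  \sum_(k < N) (quad (cQ sys) (nominal x th k) +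
                quad (cR sys) (at_time th.2 k)) +
  quad (cP sys) (nominal x th N).

(** The weight with which the covariance of the [j]-th disturbance enters the
    expected cost; it depends on the feedback part of the policy only. *)
Definition sensitivity th (j : nat) : 'M[R]_q :=
  \sum_(k < N) ((gain th k j)^T *m cQ sys *m gain th k j +
                (feedback th k j)^T *m cR sys *m feedback th k j) +
  (gain th N j)^T *m cP sys *m gain th N j.

Definition expected_cost x th S : R :=
  nominal_cost x th + \sum_(j < N) \tr (sensitivity th j *m S j).

(** The same number, sorted by stages instead of by disturbances. *)
Lemma expected_costE x th S : expected_cost x th S =
  \sum_(k < N) (mean_quad N (cQ sys) (nominal x th k) (gain th k) S +
     mean_quad N (cR sys) (at_time th.2 k) (feedback th k) S) +
  mean_quad N (cP sys) (nominal x th N) (gain th N) S.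
Proof.
rewrite /expected_cost /nominal_cost /mean_quad /sensitivity.
under [X in _ + X = _]eq_bigr do rewrite mulmxDl linearD/=.
rewrite [X in _ + X = _]big_split/= addrACA; congr (_ + _).
under [X in _ + X = _]eq_bigr do rewrite mulmx_suml linear_sum/=.
rewrite [X in _ + X = _]exchange_big -big_split/=; apply: eq_bigr => k _.
under [X in _ + X = _]eq_bigr do rewrite mulmxDl linearD/=.
by rewrite [X in _ + X = _]big_split/= addrACA.
Qed.

Lemma cost_mean (P : probability (paths R 'I_N q) R) x th S :
  (forall k, has_mean_mx P (fun w : paths R 'I_N q => w k) 0) ->
  (forall j l : 'I_N, has_mean_mx P (fun w : paths R 'I_N q => w j *m (w l)^T)
    (if j == l then S j else 0)) ->
  has_mean P (@cost R n m q sys x th) (expected_cost x th S).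
Proof.
move=> m1 m2; rewrite expected_costE.
have h p (W : 'M[R]_p) c (L : nat -> 'M[R]_(p, q)) :
    has_mean P (fun w : paths R 'I_N q =>
    quad W (c + \sum_(j < N) L j *m w j)) (mean_quad N W c L S).
  exact: (has_mean_quad (xi := fun k (w : paths R 'I_N q) => w k) W c
    (fun j : 'I_N => L j) m1 m2).
rewrite (_ : @cost R n m q sys x th = fun w : paths R 'I_N q =>
  \sum_(k < N) (quad (cQ sys) (nominal x th k +
      \sum_(j < N) gain th k j *m w j) +
    quad (cR sys) (at_time th.2 k + \sum_(j < N) feedback th k j *m w j)) +
  quad (cP sys) (nominal x th N + \sum_(j < N) gain th N j *m w j)).
  by apply: has_meanD => //; apply: has_mean_sum => k; apply: has_meanD.
apply/funext => w; rewrite /cost stateE; congr (_ + _); apply: eq_bigr => k _.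
by rewrite /stage_cost stateE -inputE at_time_ord.
Qed.

(** Telescoping of the expected stage costs: the cost of the shifted policy
    gains the terminal stage and the terminal weight one step later, which the
    Lyapunov inequality for [Kf] trades for the old terminal weight; the last
    disturbance adds [tr (G' P G S)]. *)
Lemma expected_cost_shift (Kf : 'M[R]_(m, n)) (mu : probability (borel R q) R)
    (S0 : 'M[R]_q) x th S : (0 < N)%N ->
  loewner_ge (cP sys - cQ sys - Kf^T *m cR sys *m Kf)
    ((mA sys + mB sys *m Kf)^T *m cP sys *m (mA sys + mB sys *m Kf)) ->
  has_mean_mx mu (fun w : borel R q => (w : 'cV[R]_q)) 0 ->
  has_mean_mx mu (fun w : borel R q => (w : 'cV[R]_q) *m (w : 'cV[R]_q)^T) S0 ->
  psd S0 -> (forall j, psd (S j)) ->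
  exists2 e, has_mean mu (fun w : borel R q =>
      expected_cost (step sys x (at_time th.2 0) w)
        (shift_policy Kf x th w) S) e
    & e + stage_cost sys x (at_time th.2 0) <=
      expected_cost x th (prepend_cov S0 S) +
      \tr ((mG sys)^T *m cP sys *m mG sys *m S N.-1).
Proof.
move=> N0 lyap m1 m2 pS0 pS.
(* [a] and [b] are the state and input parts of the expected stage costs of
   [th]; [beta] and [gamma] are the input cost and the final weight of the
   additional step under [Kf], apart from the last disturbance, whose
   contribution is [tau]. *)
pose St := prepend_cov S0 S; pose Acl := mA sys + mB sys *m Kf.
pose a k := mean_quad N (cQ sys) (nominal x th k) (gain th k) St.
pose b k := mean_quad N (cR sys) (at_time th.2 k) (feedback th k) St.
pose beta := mean_quad N (Kf^T *m cR sys *m Kf) (nominal x th N) (gain th N) St.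
pose gamma :=
  mean_quad N (Acl^T *m cP sys *m Acl) (nominal x th N) (gain th N) St.
pose tau := \tr ((mG sys)^T *m cP sys *m mG sys *m S N.-1).
exists (\sum_(k < N) (a k.+1 + (if (k.+1 < N)%N then b k.+1 else beta)) +
  (gamma + tau)).
  pose f (w : borel R q) : R :=
    \sum_(k < N) (
       mean_quad N (cQ sys)
         (nominal x th k.+1 + gain th k.+1 0 *m (w : 'cV[R]_q))
         (fun j => gain th k.+1 j.+1) S +
       (if (k.+1 < N)%N then
          mean_quad N (cR sys)
            (at_time th.2 k.+1 + feedback th k.+1 0 *m (w : 'cV[R]_q))
            (fun j => feedback th k.+1 j.+1) S
        else mean_quad N (Kf^T *m cR sys *m Kf)
            (nominal x th N + gain th N 0 *m (w : 'cV[R]_q))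
            (fun j => gain th N j.+1) S)) +
    (mean_quad N (Acl^T *m cP sys *m Acl)
       (nominal x th N + gain th N 0 *m (w : 'cV[R]_q))
       (fun j => gain th N j.+1) S + tau).
  rewrite (_ : (fun w => _) = f).
    apply: has_meanD; last first.
      apply: has_meanD; last exact: has_mean_cst.
      exact: mean_quad_average (gain_ge _ _).
    apply: has_mean_sum => k; apply: has_meanD.
      exact: mean_quad_average (gain_ge _ (ltn_ord k)).
    case: ifPn => h; last exact: mean_quad_average (gain_ge _ _).
    exact: mean_quad_average (feedback_ge _ (ltnW h)).
  apply/funext => w; rewrite /f expected_costE; congr (_ + _).
    apply: eq_bigr => k _; rewrite nominal_shift// at_time_shift//.
    congr (_ + _).
      rewrite /mean_quad; congr (_ + _).
      by apply: eq_bigr => j _; rewrite gain_shift.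
    case: ifPn => h; rewrite -?mean_quad_conj /mean_quad; congr (_ + _);
      by apply: eq_bigr => j _; rewrite feedback_shift// ?h// (negbTE h).
  rewrite nominal_shiftN// -mean_quad_conj /mean_quad -addrA; congr (_ + _).
  (* The last disturbance acts on the final state through [G] alone, all others
     through [Acl] alone. *)
  have N1 : (N.-1 < N)%N by rewrite prednK.
  rewrite [LHS](bigD1 (Ordinal N1))//= [X in _ = X + _](bigD1 (Ordinal N1))//=.
  rewrite prednK// gain_shiftN// prednK// eqxx (gain_ge th (leqnn N)).
  rewrite mulmx0 add0r trmx0 !mul0mx linear0 add0r addrC; congr (_ + _).
  apply: eq_bigr => j; rewrite -val_eqE/= => jN.
  rewrite gain_shiftN// ifF ?addr0//; apply/negbTE; apply: contra jN.
  by move=> jN; rewrite -eqSS prednK.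
have a0 : a 0%N = quad (cQ sys) x by rewrite /a mean_quad_gain0.
have b0 : b 0%N = quad (cR sys) (at_time th.2 0).
  by rewrite /b mean_quad_gain0// => j; rewrite feedback_ge.
have lyap' : a N + beta + gamma <=
    mean_quad N (cP sys) (nominal x th N) (gain th N) St.
  have pSt j : psd (St j) by case: j.
  have := mean_quad_ge0 N (nominal x th N) (gain th N) lyap pSt.
  rewrite !mean_quadD !mean_quadN -/(a N) -/beta -/gamma.
  by move: (a N) beta gamma (mean_quad _ _ _ _ _) => r1 r2 r3 r4; lra.
(* Both sides are the sum of the expected stage costs at times 0, ..., N. *)
have sumE : \sum_(k < N) (a k.+1 + (if (k.+1 < N)%N then b k.+1 else beta)) +
    (a 0%N + b 0%N) = \sum_(k < N) (a k + b k) + (a N + beta).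
  transitivity (\sum_(k < N.+1) (a k + (if (k < N)%N then b k else beta))).
    by rewrite [RHS]big_ord_recl/= N0 addrC.
  rewrite big_ord_recr/= ltnn; congr (_ + _).
  by apply: eq_bigr => k _; rewrite ltn_ord.
rewrite expected_costE /stage_cost -a0 -b0 -/St -/tau addrAC sumE.
by rewrite [leLHS]addrA lerD2r -addrA lerD2l.
Qed.

End expected_cost.

(** * Worst-case costs and decrease of the value function *)

Section worst_case.
Context (R : realType) (n m q : nat) (sys : mpc R n m q) (d : ambiguity R q).
Local Notation N := (horizon sys).
Local Notation W := (Wset sys).
Hypotheses (cW : closed W) (bW : bounded_set W) (adm : admissible_amb W d).
Hypotheses (pQ : psd (cQ sys)) (pR : psd (cR sys)) (pP : psd (cP sys)).
Implicit Types (x : 'cV[R]_n) (th : policy sys) (S : nat -> 'M[R]_q).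

Lemma amb_set_prod_moments (P : probability (paths R 'I_N q) R) :
  amb_set_prod W d P -> exists2 S, (forall j, cov_ball d (S j)) &
    forall x th, has_mean P (@cost R n m q sys x th) (expected_cost x th S).
Proof.
move=> [iP marg].
have /choice[mS mSP] (k : 'I_N) :
    exists z : probability (borel R q) R * 'M[R]_q,
    [/\ zero_mean_on W z.1, cov_ball d z.2, second_moment z.1 z.2 &
      forall E : set (borel R q), measurable E ->
        P [set w | E (w k)] = z.1 E].
  by have [mu [mu0 [S bS muS]] muE] := marg k; exists (mu, S).
pose S j := oapp (fun k => (mS k).2) d.2 (insub j).
exists S.
  move=> j; rewrite /S; case: insubP => [k _ _|_] /=.
    by have [] := mSP k.
  by apply: cov_ball_center; have [] := adm.
have [m1 m2] := @independent_moments _ _ _ cW bW _ P (fun k => (mS k).2)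
  (fun k => (mS k).1) iP (fun k => let: And4 h _ _ _ := mSP k in h)
  (fun k => let: And4 _ _ h _ := mSP k in h)
  (fun k => let: And4 _ _ _ h := mSP k in h).
move=> x th; apply: cost_mean => // j l.
by rewrite {1}/S valK; exact: m2.
Qed.

Lemma amb_set_prod_exists S : (forall j, cov_ball d (S j)) ->
  exists2 P : probability (paths R 'I_N q) R, amb_set_prod W d P &
    forall x th, has_mean P (@cost R n m q sys x th) (expected_cost x th S).
Proof.
move=> bS; have [_ _ bex] := adm.
have /choice[mu muP] (k : 'I_N) : exists mu : probability (borel R q) R,
    zero_mean_on W mu /\ second_moment mu (S k).
  by have [mu mu0 muS] := bex _ (bS k); exists mu.
have [P [iP marg]] := product_law_exists mu (enum_uniq 'I_N).
have {}marg k (E : set (borel R q)) : measurable E ->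
    P [set w | E (w k)] = mu k E.
  by move=> mE; apply: marg => //; rewrite mem_enum.
exists P.
  split => // k; exists (mu k); last exact: marg.
  by have [mu0 muS] := muP k; split => //; exists (S k).
have [m1 m2] := @independent_moments _ _ _ cW bW _ P (fun k : 'I_N => S k) mu iP
  (fun k => (muP k).1) (fun k => (muP k).2) marg.
by move=> x th; exact: cost_mean.
Qed.

(** Laws in the ambiguity set have covariances in the ball, and every choice of
    covariances in the ball comes from a product law: the supremum over laws is
    a supremum over covariances. *)
Lemma worst_cost_leP x th (a : \bar R) : (worst_cost d x th <= a)%E <->
  (forall S, (forall j, cov_ball d (S j)) ->
    ((expected_cost x th S)%:E <= a)%E).
Proof.
split=> [h S bS|h].
  have [P PP /(_ x th)[_ e]] := amb_set_prod_exists bS.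
  apply: le_trans h; rewrite -e; apply: ereal_sup_ubound.
  by exists P => //; rewrite unlock.
apply: ge_ereal_sup => _ [P PP <-].
have [S bS /(_ x th)[_ e]] := amb_set_prod_moments PP.
by rewrite unlock e; exact: h.
Qed.

(** The expected cost is a sum of functions of the single covariances, so worst
    covariances can be chosen one disturbance at a time. *)
Definition maximal_cov th S : Prop := forall j, cov_ball d (S j) /\
  forall T, cov_ball d T ->
    \tr (sensitivity th j *m T) <= \tr (sensitivity th j *m S j).

Lemma maximal_cov_exists th : exists S, maximal_cov th S.
Proof.
suff /choice[S maxS] : forall j, exists T, cov_ball d T /\ forall T',
    cov_ball d T' ->
    \tr (sensitivity th j *m T') <= \tr (sensitivity th j *m T).
  by exists S.
by move=> j; have [S bS Smax] := cov_ball_max (sensitivity th j) cW bW adm;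
  exists S.
Qed.

Lemma worst_costE x th S : maximal_cov th S ->
  worst_cost d x th = (expected_cost x th S)%:E.
Proof.
move=> maxS; apply/eqP; rewrite eq_le; apply/andP; split; last first.
  have /worst_cost_leP := lexx (worst_cost d x th); apply => j.
  by have [] := maxS j.
apply/worst_cost_leP => S' bS'; rewrite lee_fin lerD2l.
by apply: ler_sum => j _; exact: (maxS j).2.
Qed.

Lemma expected_cost_ge0 x th S : (forall j, psd (S j)) ->
  0 <= expected_cost x th S.
Proof.
move=> pS; rewrite expected_costE addr_ge0 ?mean_quad_ge0// sumr_ge0// => k _.
by rewrite addr_ge0 ?mean_quad_ge0.
Qed.

Lemma worst_cost_ge0 x th : (0 <= worst_cost d x th)%E.
Proof.
have [S maxS] := maximal_cov_exists th; rewrite (worst_costE x maxS) lee_fin.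
by apply: expected_cost_ge0 => j; have [[]] := maxS j.
Qed.

Lemma optimal_cost_ge0 x : (0 <= optimal_cost sys d x)%E.
Proof.
by apply: le_ereal_inf_tmp => _ [th _ <-]; exact: worst_cost_ge0.
Qed.

Lemma optimal_cost_infeasible x :
  ~ feasible sys x -> optimal_cost sys d x = +oo%E.
Proof.
move=> fx; rewrite /optimal_cost (_ : [set _ | _ in _] = set0) ?ereal_inf0//.
by apply/seteqP; split => // c [th fth _]; apply: fx; exists th.
Qed.

Lemma optimal_cost_le x th : feasible_policy sys x th ->
  (optimal_cost sys d x <= worst_cost d x th)%E.
Proof. by move=> fth; apply: ereal_inf_lbound; exists th. Qed.

(** The maximizing covariances of the shifted policy do not depend on the
    observed disturbance, so the average over it of the worst case is an expected
    cost, to which [expected_cost_shift] applies; an expected cost of [th] is at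
    most its worst cost. *)
Lemma optimal_cost_decrease (Kf : 'M[R]_(m, n)) (M : R) x th
    (mu : probability (borel R q) R) : (0 < N)%N ->
  loewner_ge (cP sys - cQ sys - Kf^T *m cR sys *m Kf)
    ((mA sys + mB sys *m Kf)^T *m cP sys *m (mA sys + mB sys *m Kf)) ->
  (forall x w, Xfset sys x -> W w -> Zset sys (x, Kf *m x) /\
     Xfset sys ((mA sys + mB sys *m Kf) *m x + mG sys *m w)) ->
  (forall T, cov_ball d T -> \tr ((mG sys)^T *m cP sys *m mG sys *m T) <= M) ->
  measurable_fun setT (optimal_cost sys d : borel R n -> \bar R) ->
  amb_set W d mu -> optimal_policy sys d x th ->
  (\int[mu]_w optimal_cost sys d (step sys x (at_time th.2 0) w) +
    (stage_cost sys x (at_time th.2 0))%:E <= optimal_cost sys d x + M%:E)%E.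
Proof.
move=> N0 lyap term hM mV [mu0 [S0 bS0 muS]] [fth opt].
have [m1 m2] := zero_mean_onP cW bW mu0 muS.
have [S maxS] := maximal_cov_exists (shift_policy Kf x th 0).
(* The sensitivities of the shifted policy are the same for all [w]. *)
have maxS' w : maximal_cov (shift_policy Kf x th w) S.
  move=> j; have [bS Smax] := maxS j; split => // S' bS'.
  suff -> : sensitivity (shift_policy Kf x th w) j =
    sensitivity (shift_policy Kf x th 0) j by exact: Smax.
  have fbE k i : feedback (shift_policy Kf x th w) k i =
    feedback (shift_policy Kf x th 0) k i by [].
  have gE k i : gain (shift_policy Kf x th w) k i =
      gain (shift_policy Kf x th 0) k i.
    by elim: k => // k ih; rewrite !gainS ih fbE.
  by rewrite /sensitivity gE; under eq_bigr do rewrite gE fbE.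
have bS j : cov_ball d (S j) by have [] := maxS j.
have pS j : psd (S j) by have [] := bS j.
have pS0 : psd S0 by have [] := bS0.
have [e [ie e_] le_e] := expected_cost_shift x th N0 lyap m1 m2 pS0 pS.
have hmstep : measurable_fun setT (fun w : borel R q =>
    (step sys x (at_time th.2 0) (w : 'cV[R]_q) : borel R n)).
  apply: measurable_colvec => i; rewrite /step.
  rewrite (_ : (fun t => _) = fun w : borel R q =>
    (mA sys *m x + mB sys *m at_time th.2 0) i ord0 +
    \sum_j mG sys i j * (w : 'cV[R]_q) j ord0).
    apply: measurable_funD; first exact: measurable_cst.
    apply: measurable_sum => j; apply: measurable_funM => //.
    exact: measurable_entry.
  by apply/funext => w; rewrite mxE [X in _ + X = _]mxE.
apply: (@le_trans _ _ (e + stage_cost sys x (at_time th.2 0))%:E).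
  rewrite [leRHS]EFinD; apply: leeD => //; rewrite -e_; have [muW _] := mu0.
  apply: ae_ge0_le_integral => //.
  - by move=> w _; exact: optimal_cost_ge0.
  - exact: (measurableT_comp mV hmstep).
  - by move=> w _; rewrite lee_fin; exact: expected_cost_ge0.
  - exact: measurable_int ie.
  - exists (~` (W : set (borel R q))); split.
    + exact: measurableC (closed_borel cW).
    + exact: probability_setC0 (closed_borel cW) muW.
    + move=> w /= h Ww; apply: h => _.
      rewrite -(worst_costE _ (maxS' w)); apply: optimal_cost_le.
      exact: feasible_shift.
apply: (@le_trans _ _ (expected_cost x th (prepend_cov S0 S) + M)%:E).
  by rewrite lee_fin (le_trans le_e)// lerD2l; exact: hM.
rewrite [leLHS]EFinD; apply: leeD => //; rewrite -opt.
have /worst_cost_leP := lexx (worst_cost d x th); apply => j.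
by case: j => [|j] //=.
Qed.

End worst_case.

(** * Measurability of the value function *)

Lemma measurable_sublevel (R : realType) d (T : measurableType d)
    (f : T -> \bar R) :
  (forall a : R, measurable [set x | (f x <= a%:E)%E]) -> measurable_fun setT f.
Proof.
move=> h; apply: (measurability _ (ErealGenOInfty.measurableE R)).
move=> _ [_ [a ->] <-]; rewrite setTI.
rewrite (_ : _ @^-1` _ = ~` [set x | (f x <= a%:E)%E]).
  exact: measurableC.
apply/seteqP; split => x /=; rewrite in_itv/= andbT ltNge.
  by move=> /negP.
by move=> /negP.
Qed.

(** The projection of a closed set is a countable union of compact sets, hence
    a Borel set. *)
Lemma projection_measurable (R : realType) n p
    (C : set ('cV[R]_n * 'rV[R]_p)) : closed C ->
  measurable (fst @` C : set (borel R n)).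
Proof.
move=> cC.
pose box a b r := [set M : 'M[R]_(a, b) | forall i j, `|M i j| <= r].
rewrite (_ : _ @` C = \bigcup_k (fst @` (C `&`
    (box n 1%N k%:R `*` box 1%N p k%:R)))).
  apply: bigcupT_measurable => k; apply: closed_borel.
  apply: compact_closed; first exact: norm_hausdorff.
  apply: continuous_compact.
    by apply: continuous_subspaceT => z; exact: cvg_fst.
  have cB := compact_setX (@compact_box R n 1 k%:R) (@compact_box R 1 p k%:R).
  apply: (subclosed_compact _ cB); last by move=> z [].
  by apply: closedI => //; exact: (compact_closed _ cB).
apply/seteqP; split => x; last by move=> [k _ [z [Cz _] <-]]; exists z.
move=> [[y v] Cyv <-]; pose r : R := `|y| + `|v|.
exists (Num.trunc r).+1 => //; exists (y, v) => //; split => //.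
have hr : r <= (Num.trunc r).+1%:R.
  have /andP[_ /ltW] := trunc_itv (addr_ge0 (normr_ge0 y) (normr_ge0 v)).
  by [].
split => i j /=.
  by rewrite (le_trans (entry_le_norm y i j))// (le_trans _ hr)// lerDl.
by rewrite (le_trans (entry_le_norm v i j))// (le_trans _ hr)// lerDr.
Qed.

Section policy_coordinates.
Context (R : realType) (n m q : nat) (sys : mpc R n m q).
Local Notation N := (horizon sys).

(** Coordinates that turn the space of policies into a space of row vectors,
    where closed bounded sets are compact. *)
Definition policy_index := (('I_N * 'I_N * ('I_m * 'I_q)) + ('I_N * 'I_m))%type.

Definition decode (v : 'rV[R]_#|{: policy_index}|) : policy sys :=
  (fun i j => \matrix_(a, b) v ord0 (enum_rank (inl (i, j, (a, b)))),
   fun i => \col_a v ord0 (enum_rank (inr (i, a)))).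

Lemma decode_surj th : exists v, decode v = th.
Proof.
exists (\row_k match enum_val k with
  | inl (i, j, (a, b)) => th.1 i j a b
  | inr (i, a) => th.2 i a ord0 end).
case: th => M v; rewrite /decode; congr (_, _).
  by apply/funext => i; apply/funext => j; apply/matrixP => a b;
    rewrite !mxE enum_rankK.
by apply/funext => i; apply/matrixP => a b; rewrite !mxE enum_rankK (ord1 b).
Qed.

Local Notation pair := ('cV[R]_n * 'rV[R]_#|{: policy_index}|)%type.

Let ccst (V : topologicalType) (c : V) : continuous (fun _ : pair => c).
Proof. exact: cst_continuous. Qed.

Let csnd : continuous (snd : pair -> _).
Proof. by move=> z; exact: cvg_snd. Qed.

Lemma continuous_block i j : continuous (fun z : pair => (decode z.2).1 i j).
Proof.
apply: continuous_mx => a b; under eq_fun do rewrite mxE.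
exact: continuous_entry csnd.
Qed.

Lemma continuous_offset k :
  continuous (fun z : pair => at_time (decode z.2).2 k).
Proof.
rewrite /at_time; case: (insub k) => [i|] /=; last exact: ccst.
apply: continuous_mx => a b; under eq_fun do rewrite mxE.
exact: continuous_entry csnd.
Qed.

Lemma continuous_fbgain k j :
  continuous (fun z : pair => feedback (decode z.2) k j).
Proof.
rewrite /feedback; case: (j < k)%N; last exact: ccst.
case: (insub k) => [i|] /=; last exact: ccst.
case: (insub j) => [l|] /=; last exact: ccst.
exact: continuous_block.
Qed.

Lemma continuous_gain k j : continuous (fun z : pair => gain (decode z.2) k j).
Proof.
elim: k => [|k ih] /=; first exact: ccst.
apply: continuous_add; last exact: ccst.
apply: continuous_add; apply: continuous_mulmx => //; try exact: ccst.
exact: continuous_fbgain.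
Qed.

Lemma continuous_nominal k :
  continuous (fun z : pair => nominal z.1 (decode z.2) k).
Proof.
elim: k => [|k ih] /=; first by move=> z; exact: cvg_fst.
apply: continuous_add; apply: continuous_mulmx => //; try exact: ccst.
exact: continuous_offset.
Qed.

Lemma continuous_state w k :
  continuous (fun z : pair => state z.1 (decode z.2) w k).
Proof.
under eq_fun do rewrite stateE; apply: continuous_add.
  exact: continuous_nominal.
apply: continuous_sum => j; apply: continuous_mulmx; last exact: ccst.
exact: continuous_gain.
Qed.

Lemma continuous_input w (k : 'I_N) :
  continuous (fun z : pair => input (decode z.2) w k).
Proof.
under eq_fun do rewrite -at_time_ord inputE; apply: continuous_add.
  exact: continuous_offset.
apply: continuous_sum => j; apply: continuous_mulmx; last exact: ccst.
exact: continuous_fbgain.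
Qed.

Lemma continuous_expected_cost S :
  continuous (fun z : pair => expected_cost z.1 (decode z.2) S).
Proof.
have h p (W : 'M[R]_p) (c : pair -> 'cV[R]_p)
      (L : pair -> nat -> 'M[R]_(p, q)) :
    continuous c -> (forall j, continuous (fun z => L z j)) ->
    continuous (fun z => mean_quad N W (c z) (L z) S).
  move=> cc cL; apply: continuous_add.
    by apply: continuous_quad => //; exact: ccst.
  apply: continuous_sum => j; apply: continuous_mxtrace.
  apply: continuous_mulmx; last exact: ccst.
  apply: continuous_mulmx; last exact: cL.
  by apply: continuous_mulmx; [apply: continuous_trmx; exact: cL|exact: ccst].
under eq_fun do rewrite expected_costE; apply: continuous_add.
  apply: continuous_sum => k; apply: continuous_add; apply: h.
  - exact: continuous_nominal.
  - by move=> j; exact: continuous_gain.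
  - exact: continuous_offset.
  - by move=> j; exact: continuous_fbgain.
apply: h; first exact: continuous_nominal.
by move=> j; exact: continuous_gain.
Qed.

(** For each disturbance sequence the constraints are preimages of closed sets
    under continuous maps of state and policy. *)
Lemma closed_feasible_pairs : closed (Zset sys) -> closed (Xfset sys) ->
  closed [set z : pair | feasible_policy sys z.1 (decode z.2)].
Proof.
move=> cZ cX.
rewrite (_ : [set z | _] =
  \bigcap_(i in [set: 'I_N]) \bigcap_(j in [set j : 'I_N | (i <= j)%N])
    [set z : pair | (decode z.2).1 i j = 0] `&`
  \bigcap_(w in [set w : 'I_N -> 'cV[R]_q | forall k, Wset sys (w k)])
    (\bigcap_(k in [set: 'I_N]) [set z : pair |
       Zset sys (state z.1 (decode z.2) w k, input (decode z.2) w k)] `&`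
     [set z : pair | Xfset sys (state z.1 (decode z.2) w N)])).
  apply: closedI.
    apply: closed_bigI => i _; apply: closed_bigI => j _.
    exact/closed_eq0_mx/continuous_block.
  apply: closed_bigI => w _; apply: closedI.
    apply: closed_bigI => k _.
    apply: (@closed_comp _ _ (fun z : pair =>
      (state z.1 (decode z.2) w k, input (decode z.2) w k))) => // z _.
    exact: (cvg_pair (@continuous_state w k z) (@continuous_input w k z)).
  apply: (@closed_comp _ _ (fun z : pair => state z.1 (decode z.2) w N)) => //.
  move=> z _; exact: continuous_state.
apply/seteqP; split => z /=.
  move=> [cz fz]; split => [i _ j ij|w Ww]; first exact: cz.
  by have [hZ hX] := fz w Ww; split => // k _; exact: hZ.
move=> [cz fz]; split => [i j ij|w Ww]; first exact: cz.
by have [hZ hX] := fz w Ww; split => // k; exact: hZ.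
Qed.

Lemma feasible_measurable : closed (Zset sys) -> closed (Xfset sys) ->
  measurable (feasible sys : set (borel R n)).
Proof.
move=> cZ cX; have := projection_measurable (closed_feasible_pairs cZ cX).
congr measurable; apply/seteqP; split => [x [[y v] /= fv <-]|x [th fth]].
  by exists (decode v).
by have [v vth] := decode_surj th; exists (x, v) => //=; rewrite vth.
Qed.

(** Sublevel sets of the value function are projections of closed sets because
    the infimum over policies is attained. *)
Lemma optimal_cost_measurable (d : ambiguity R q) :
  closed (Wset sys) -> bounded_set (Wset sys) -> admissible_amb (Wset sys) d ->
  closed (Zset sys) -> closed (Xfset sys) ->
  (forall x, feasible sys x -> exists th, optimal_policy sys d x th) ->
  measurable_fun setT (optimal_cost sys d : borel R n -> \bar R).
Proof.
move=> cW bW adm cZ cX att; apply: measurable_sublevel => a.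
pose C := [set z : pair | feasible_policy sys z.1 (decode z.2)] `&`
  \bigcap_(S in [set S : nat -> 'M[R]_q | forall j, cov_ball d (S j)])
    [set z : pair | expected_cost z.1 (decode z.2) S <= a].
have cC : closed C.
  apply: closedI; first exact: closed_feasible_pairs.
  apply: closed_bigI => S _; apply: closed_le_fun.
  exact: continuous_expected_cost.
have CP z : C z <-> feasible_policy sys z.1 (decode z.2) /\
    (worst_cost d z.1 (decode z.2) <= a%:E)%E.
  split=> -[fz h]; split=> //.
    by apply/(worst_cost_leP cW bW adm) => S bS; rewrite lee_fin; exact: h.
  move=> S bS; have /(worst_cost_leP cW bW adm)/(_ S bS) := h.
  by rewrite lee_fin.
have := projection_measurable cC; congr measurable.
apply/seteqP; split => [x [[y v] /CP[/= fv wv] <-]|x /= Vx].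
  by rewrite /= (le_trans (optimal_cost_le d fv)).
have fx : feasible sys x.
  apply: contrapT => nfx; move: Vx.
  by rewrite (optimal_cost_infeasible d nfx) leye_eq.
have [th [fth opt]] := att x fx; have [v vth] := decode_surj th.
exists (x, v) => //; apply/CP; split => /=; first by rewrite vth.
by rewrite vth opt.
Qed.

End policy_coordinates.

(** * The closed loop *)

Lemma measurable_continuous (R : realType) n (f : 'cV[R]_n -> R) :
  continuous f -> measurable_fun setT (f : borel R n -> R).
Proof.
move=> cf; apply: (measurability _ (RGenOpens.measurableE R)).
move=> _ [B [a [b ->]] <-]; rewrite setTI; apply: sub_sigma_algebra => /=.
by apply: open_comp => [x _|]; [exact: cf|exact: itv_open].
Qed.

Lemma measurable_mulmx (R : realType) n p d (T : measurableType d)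
    (A : 'M[R]_(n, p)) (f : T -> 'cV[R]_p) :
  measurable_fun setT (f : T -> borel R p) ->
  measurable_fun setT (fun t => A *m f t : borel R n).
Proof.
move=> mf; apply: measurable_colvec => i.
rewrite (_ : (fun t => _) = fun t => \sum_j A i j * f t j ord0).
  apply: measurable_sum => j; apply: measurable_funM => //.
  exact: (measurableT_comp (@measurable_entry R p j) mf).
by apply/funext => t; rewrite mxE.
Qed.

Lemma measurable_addmx (R : realType) n d (T : measurableType d)
    (f g : T -> 'cV[R]_n) :
  measurable_fun setT (f : T -> borel R n) ->
  measurable_fun setT (g : T -> borel R n) ->
  measurable_fun setT (fun t => f t + g t : borel R n).
Proof.
move=> mf mg; apply: measurable_colvec => i.
rewrite (_ : (fun t => _) = fun t => f t i ord0 + g t i ord0).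
  apply: measurable_funD.
    exact: (measurableT_comp (@measurable_entry R n i) mf).
  exact: (measurableT_comp (@measurable_entry R n i) mg).
by apply/funext => t; rewrite mxE.
Qed.

Section closed_loop_cost.
Context (R : realType) (n m q : nat) (sys : mpc R n m q) (d : ambiguity R q).
Local Notation N := (horizon sys).
Local Notation W := (Wset sys).
Variables (hN : (0 < N)%N) (kappa : 'cV[R]_n -> 'cV[R]_m).
Hypotheses (cW : closed W) (bW : bounded_set W) (adm : admissible_amb W d).
Hypotheses (cZ : closed (Zset sys)) (cX : closed (Xfset sys)).
Hypotheses (pQ : psd (cQ sys)) (pR : psd (cR sys)) (pP : psd (cP sys)).
Hypothesis ctrl : control_law hN d kappa.
Variable Kf : 'M[R]_(m, n).
Hypothesis lyap : loewner_ge (cP sys - cQ sys - Kf^T *m cR sys *m Kf)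
  ((mA sys + mB sys *m Kf)^T *m cP sys *m (mA sys + mB sys *m Kf)).
Hypothesis term : forall x w, Xfset sys x -> W w ->
  Zset sys (x, Kf *m x) /\
  Xfset sys ((mA sys + mB sys *m Kf) *m x + mG sys *m w).
Variable M : R.
Hypothesis hM : forall T, cov_ball d T ->
  \tr ((mG sys)^T *m cP sys *m mG sys *m T) <= M.

Let kappaP x : feasible sys x -> exists2 th, optimal_policy sys d x th &
  kappa x = at_time th.2 0.
Proof.
move=> fx; have [_ _ /(_ x fx)[th opt ->]] := ctrl; exists th => //.
by rewrite -[0%N]/(val (Ordinal hN)) at_time_ord.
Qed.

Lemma feasible_invariant x w : feasible sys x -> W w ->
  feasible sys (step sys x (kappa x) w).
Proof.
move=> /kappaP[th [fth _] ->] Ww.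
by exists (shift_policy Kf x th w); exact: feasible_shift.
Qed.

Let mV : measurable_fun setT (optimal_cost sys d : borel R n -> \bar R).
Proof.
by apply: optimal_cost_measurable => // x /kappaP[th opt _]; exists th.
Qed.

Let V0 x : (0 <= optimal_cost sys d x)%E.
Proof. exact: optimal_cost_ge0. Qed.

Let M0 : 0 <= M.
Proof.
have [_ pd _] := adm; apply: le_trans (hM (cov_ball_center pd)).
by apply: psd_trace_mul_ge0 => //; exact: psd_conj.
Qed.

(** Extending the control law by [0] off the feasible set makes it measurable
    on the whole space; the value function is infinite there, so the decrease
    of the value function holds at every state. *)
Definition kappa_ext (x : 'cV[R]_n) : 'cV[R]_m :=
  if `[< feasible sys x >] then kappa x else 0.

Lemma measurable_kappa_ext :
  measurable_fun setT (kappa_ext : borel R n -> borel R m).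
Proof.
have mX := feasible_measurable cZ cX; have [mk _ _] := ctrl.
move=> _ E mE; rewrite setTI.
rewrite (_ : _ @^-1` E = (feasible sys `&` kappa @^-1` E) `|`
    ((~` feasible sys) `&` [set _ | E 0])).
  apply: measurableU; first exact: mk.
  apply: measurableI; first exact: measurableC.
  have [E0|E0] := pselect (E 0).
    by rewrite (_ : [set _ | _] = setT)//; apply/seteqP; split.
  by rewrite (_ : [set _ | _] = set0)//; apply/seteqP; split.
apply/seteqP; split => x; rewrite /kappa_ext /=.
  by case: asboolP => fx Ex; [left|right].
by case: asboolP => fx [] [].
Qed.

Lemma stage_cost_ge0 x u : 0 <= stage_cost sys x u.
Proof. by rewrite addr_ge0//; [case: pQ|case: pR]. Qed.

Lemma value_decrease (mu : probability (borel R q) R) x : amb_set W d mu ->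
  (\int[mu]_w optimal_cost sys d (step sys x (kappa_ext x) w) +
    (stage_cost sys x (kappa_ext x))%:E <= optimal_cost sys d x + M%:E)%E.
Proof.
move=> muP; rewrite /kappa_ext; case: asboolP => fx.
  have [th opt ->] := kappaP fx.
  exact: (optimal_cost_decrease cW bW adm pQ pR pP hN lyap term hM mV muP opt).
by rewrite (optimal_cost_infeasible d fx) addye// leey.
Qed.

Variables (x : 'cV[R]_n) (P : probability (paths R nat q) R).
Hypothesis amb : amb_set_prod W d P.
Local Notation y :=
  (fun i (w : paths R nat q) => closed_loop sys kappa_ext x w i).

Lemma measurable_closed_loop i : measurable_fun setT (y i : _ -> borel R n).
Proof.
elim: i => [|i ih] /=; first exact: measurable_cst.
rewrite /step; apply: measurable_addmx; last first.
  exact: measurable_mulmx (@measurable_coordinate R nat q i).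
apply: measurable_addmx; first exact: measurable_mulmx.
by apply: measurable_mulmx; exact: (measurableT_comp measurable_kappa_ext ih).
Qed.

Definition running_cost i (w : paths R nat q) : R :=
  stage_cost sys (y i w) (kappa_ext (y i w)).

Lemma measurable_running_cost i : measurable_fun setT (running_cost i).
Proof.
have my := measurable_closed_loop i.
apply: measurable_funD.
  exact: (measurableT_comp
    (measurable_continuous (@continuous_quadr _ _ _)) my).
exact: (measurableT_comp (measurable_continuous (@continuous_quadr _ _ _))
  (measurableT_comp measurable_kappa_ext my)).
Qed.

Lemma closed_loop_update w v i k : (i <= k)%N ->
  closed_loop sys kappa_ext x (update k w v) i =
  closed_loop sys kappa_ext x w i.
Proof.
elim: i => //= i ih ik; rewrite ih ?(ltnW ik)//.
by rewrite /update ltn_eqF.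
Qed.

Local Open Scope ereal_scope.

(** The state at time [i] does not involve the disturbance at time [i]: once
    this disturbance is resampled, the inner integral is the one-step average of the
    value function at that state. *)
Lemma mean_value_decrease i :
  \int[P]_w optimal_cost sys d (y i.+1 w) + \int[P]_w (running_cost i w)%:E <=
  \int[P]_w optimal_cost sys d (y i w) + M%:E.
Proof.
have [iP marg] := amb; have [mu muP muE] := marg i.
have mVy k : measurable_fun setT (fun w => optimal_cost sys d (y k w)).
  exact: (measurableT_comp mV (measurable_closed_loop k)).
rewrite (ge0_integral_resample iP muE (mVy i.+1) (fun=> V0 _)).
pose F (w : paths R nat q) :=
  \int[mu]_v optimal_cost sys d (y i.+1 (update i w v)).
have F0 w : 0 <= F w by apply: integral_ge0 => v _; exact: V0.
have mF : measurable_fun setT (F : paths R nat q -> \bar R).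
  apply: (@measurable_fun_fubini_tonelli_F _ _ _ _ _ mu
    (fun z : paths R nat q * borel R q =>
      optimal_cost sys d (y i.+1 (resample i z)))); last by move=> z; exact: V0.
  exact: (measurableT_comp (mVy i.+1) (@measurable_resample R nat q i)).
have mL : measurable_fun setT (EFin \o running_cost i).
  by apply/measurable_EFinP; exact: measurable_running_cost.
have L0 w : 0 <= (running_cost i w)%:E.
  by rewrite lee_fin; exact: stage_cost_ge0.
have eL : \int[P]_w F w + \int[P]_w (running_cost i w)%:E =
    \int[P]_w (F w + (running_cost i w)%:E).
  exact/esym/(ge0_integralD P measurableT (fun w _ => F0 w) mF
    (fun w _ => L0 w) mL).
have eR : \int[P]_w optimal_cost sys d (y i w) + M%:E =
    \int[P]_w (optimal_cost sys d (y i w) + M%:E).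
  rewrite ge0_integralD//.
  congr (_ + _); rewrite integral_cst// -[LHS]mule1; congr (_ * _).
  exact/esym/probability_setT.
rewrite eR eL; apply: ge0_le_integral => //.
- by move=> w _; rewrite adde_ge0.
- exact: emeasurable_funD.
- by apply: emeasurable_funD.
- move=> w _; rewrite /F.
  under eq_integral do rewrite /= closed_loop_update// /update eqxx.
  exact: value_decrease.
Qed.

Lemma mean_running_cost_sum k :
  \sum_(i < k) \int[P]_w (running_cost i w)%:E <=
  optimal_cost sys d x + (k%:R * M)%:E.
Proof.
suff : \int[P]_w optimal_cost sys d (y k w) +
    \sum_(i < k) \int[P]_w (running_cost i w)%:E <=
    optimal_cost sys d x + (k%:R * M)%:E.
  by apply: le_trans; apply: leeDr; apply: integral_ge0 => w _; exact: V0.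
elim: k => [|k ih].
  rewrite big_ord0 adde0 mul0r adde0.
  rewrite (eq_integral (cst (optimal_cost sys d x)))//.
  rewrite integral_cst// -[leRHS]mule1; apply: lee_wpmul2l => //.
  exact: probability_le1.
rewrite big_ord_recr/= [X in _ + X]addeC addeA.
rewrite (le_trans (leeD (mean_value_decrease k) (lexx _)))//.
rewrite addeAC mulrSr mulrDl mul1r EFinD addeA.
exact: leeD.
Qed.

Lemma feasible_closed_loop w i : feasible sys x -> (forall j, W (w j)) ->
  feasible sys (closed_loop sys kappa_ext x w i) /\
  closed_loop sys kappa x w i = closed_loop sys kappa_ext x w i.
Proof.
move=> fx Ww; elim: i => [//|i [fi ei]] /=; rewrite ei.
have -> : kappa_ext (closed_loop sys kappa_ext x w i) =
    kappa (closed_loop sys kappa_ext x w i).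
  by rewrite /kappa_ext; case: asboolP.
by split => //; exact: feasible_invariant.
Qed.

(** On disturbance sequences in [W] the closed loop stays feasible, where
    [kappa] and its extension agree; the integrand is nonnegative, so integrating over
    all sequences gives an upper bound. *)
Lemma avg_performance_le k : feasible sys x ->
  avg_performance sys kappa x P k <=
  (k%:R^-1)%:E * (optimal_cost sys d x + (k%:R * M)%:E).
Proof.
move=> fx; rewrite /avg_performance.
set D := [set w | _].
have mD : measurable D.
  rewrite (_ : D = \bigcap_i
      ((fun w : paths R nat q => (w i : borel R q)) @^-1` W)).
    apply: bigcapT_measurable => i; rewrite -[X in measurable X]setTI.
    by apply: measurable_coordinate => //; exact: closed_borel.
  by apply/seteqP; split => w /= h; [move=> i _; exact: h|move=> i; exact: h].
pose avg (w : paths R nat q) :=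
  (k%:R^-1)%:E * \sum_(i < k) (running_cost i w)%:E.
have L0 i w : 0 <= (running_cost i w)%:E.
  by rewrite lee_fin; exact: stage_cost_ge0.
have mL i : measurable_fun setT (fun w => (running_cost i w)%:E).
  by apply/measurable_EFinP; exact: measurable_running_cost.
have msum : measurable_fun setT (fun w => \sum_(i < k) (running_cost i w)%:E).
  by apply: emeasurable_sum.
rewrite (eq_integral avg); last first.
  move=> w; rewrite inE => Dw; rewrite /avg sumEFin -EFinM; congr (_ * _)%:E.
  apply: eq_bigr => i _; rewrite /running_cost.
  have [fi ->] := feasible_closed_loop i fx Dw.
  by rewrite /kappa_ext; case: asboolP.
have k0 : 0 <= (k%:R^-1)%:E :> \bar R by rewrite lee_fin invr_ge0.
apply: (@le_trans _ _ (\int[P]_w avg w)).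
  apply: ge0_subset_integral => //.
    exact: measurable_funeM.
  by move=> w _; rewrite mule_ge0// sume_ge0.
rewrite ge0_integralZl//; last by move=> w _; rewrite sume_ge0.
rewrite ge0_integral_sum//.
by apply: lee_wpmul2l => //; exact: mean_running_cost_sum.
Qed.

Lemma limsup_avg_performance : feasible sys x ->
  limn_esup (avg_performance sys kappa x P) <= M%:E.
Proof.
move=> fx; have [th [fth opt] _] := kappaP fx.
have [S maxS] := maximal_cov_exists cW bW adm th.
have VE : optimal_cost sys d x = (expected_cost x th S)%:E.
  by rewrite -opt (worst_costE cW bW adm _ maxS).
set v := expected_cost x th S in VE.
have v0 : (0 <= v)%R by rewrite -lee_fin -VE.
apply/lee_addgt0Pr => e e0.
(* From time [K] on, the initial value [v] weighs at most [e] in the average. *)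
pose K := (Num.trunc (v / e)).+1.
have vK k : (K <= k)%N -> (v / k%:R <= e)%R.
  move=> Kk; have k0 : (0 < k%:R :> R)%R by rewrite ltr0n (leq_trans _ Kk).
  rewrite ler_pdivrMr// -ler_pdivrMl//.
  have /andP[_ h] := trunc_itv (divr_ge0 v0 (ltW e0)).
  by rewrite mulrC (le_trans (ltW h))// ler_nat.
rewrite /limn_esup /limf_esup.
apply: (@le_trans _ _ (ereal_sup (avg_performance sys kappa x P @`
    [set k | (K <= k)%N]))).
  apply: ereal_inf_lbound; exists [set k | (K <= k)%N] => //.
  by exists K.
apply: ge_ereal_sup => _ [k /= Kk <-].
apply: (le_trans (avg_performance_le k fx)); rewrite VE -EFinD -EFinM lee_fin.
have k0 : (k%:R != 0 :> R)%R by rewrite pnatr_eq0 -lt0n (leq_trans _ Kk).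
rewrite mulrDr mulKf// [leRHS]addrC lerD2r mulrC; exact: vK.
Qed.

End closed_loop_cost.

Theorem theorem3p1 (R : realType) (n m q : nat) (sys : mpc R n m q)
    (kappa : ambiguity R q -> 'cV[R]_n -> 'cV[R]_m)
    (hN : (0 < horizon sys)%N)
    (hZU : forall z, Zset sys z -> Uset sys z.2)
    (hkappa : forall d, admissible_amb (Wset sys) d ->
       control_law hN d (kappa d))
    (hclosed : [/\ closed (Uset sys), closed (Wset sys), closed (Zset sys) &
       closed (Xfset sys)])
    (hconvex : [/\ convex_set (Uset sys), convex_set (Wset sys),
       convex_set (Zset sys) & convex_set (Xfset sys)])
    (horigin : [/\ Uset sys 0, Wset sys 0, Zset sys (0, 0) & Xfset sys 0])
    (hbounded : bounded_set (Uset sys) /\ bounded_set (Wset sys))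
    (hWint : interior (Wset sys) 0)
    (hpsd : [/\ psd (cQ sys), psd (cR sys) & psd (cP sys)])
    (hterminal : exists Kf : 'M[R]_(m, n),
       loewner_ge (cP sys - cQ sys - Kf^T *m cR sys *m Kf)
         ((mA sys + mB sys *m Kf)^T *m cP sys *m (mA sys + mB sys *m Kf)) /\
       interior (Xfset sys) 0 /\
       forall x w, Xfset sys x -> Wset sys w ->
         Zset sys (x, Kf *m x) /\
         Xfset sys ((mA sys + mB sys *m Kf) *m x + mG sys *m w)) :
  (forall x w d, feasible sys x -> Wset sys w -> admissible_amb (Wset sys) d ->
     feasible sys (step sys x (kappa d x) w)) /\
  (forall x d, feasible sys x -> admissible_amb (Wset sys) d ->
   forall P : probability (paths R nat q) R, amb_set_prod (Wset sys) d P ->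
   exists2 M : R,
     is_max [set \tr ((mG sys)^T *m cP sys *m mG sys *m Sigma)
              | Sigma in cov_ball d] M &
     (limn_esup (avg_performance sys (kappa d) x P) <= M%:E)%E).
Proof.
have [_ cW cZ cX] := hclosed; have [_ bW] := hbounded.
have [pQ pR pP] := hpsd; have [Kf [lyap [_ term]]] := hterminal.
split=> [x w d fx Ww adm|x d fx adm P PP].
  exact: (feasible_invariant (hkappa d adm) term fx Ww).
have [S bS Smax] := cov_ball_max ((mG sys)^T *m cP sys *m mG sys) cW bW adm.
exists (\tr ((mG sys)^T *m cP sys *m mG sys *m S)).
  by split; [exists S|move=> _ [S' bS' <-]; exact: Smax].
exact: (limsup_avg_performance cW bW adm cZ cX pQ pR pP (hkappa d adm) lyap term
  Smax PP fx).
Qed.
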